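(* Let $\rho>0$, $A>0$, $R>0$, $J>0$, $C_f>0$ be constants, let $a'<0$ be a constant, let $\beta\in[\beta_{\min},\beta_{\max}]$ and $V_w>0$ be constants, and let $C_p:(0,\infty)\times[\beta_{\min},\beta_{\max}]\to\mathbb{R}$ satisfy: (A1) $C_p(\lambda,\beta)$ is continuously differentiable in both $\lambda$ and $\beta$ on $(0,\infty)\times[\beta_{\min},\beta_{\max}]$; (A2) there exists $c\in(0,\infty)$ with $C_p(\lambda,\beta)\le c\lambda$ for all $\lambda\in(0,\infty)$, $\beta\in[\beta_{\min},\beta_{\max}]$; (A3) for each fixed $\beta\in[\beta_{\min},\beta_{\max}]$ there exists $\lambda_1\in(0,\infty)$ with $C_p(\lambda,\beta)>0$ for all $\lambda\in(0,\lambda_1)$; (A4) there exist $\underline{c}\in(-\infty,0)$ and $\overline{c}\in(0,\infty)$ with $\underline{c}\le\frac{\partial}{\partial\lambda}\big(\frac{C_p(\lambda,\beta)}{\lambda}\big)\le\overline{c}$ for all $\lambda\in(0,\infty)$, $\beta\in[\beta_{\min},\beta_{\max}]$. Define, for $\omega_r>0$, $$g(\omega_r,\beta,V_w)=\frac{\tfrac12\rho A\, C_p\!\big(\tfrac{\omega_r R}{V_w},\beta\big)V_w^3}{\omega_r}-a'-C_f\omega_r .$$ Let $\omega_r^{(1)}\in(0,\infty)$ be such that $g(\omega_r^{(1)},\beta,V_w)=0$ and $g(\omega_r,\beta,V_w)>0$ for all $\omega_r\in(0,\omega_r^{(1)})$, and let $\underline{\gamma}\in(-\infty,0)$, $\overline{\gamma}\in(0,\infty)$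 be such that $\underline{\gamma}\le\frac{\partial}{\partial\omega_r}g(\omega_r,\beta,V_w)\le\overline{\gamma}$ for all $\omega_r\in(0,\infty)$. Consider the closed-loop system in the state $(\omega_r,\hat g)$: $$\dot\omega_r=\frac1J\Big(g(\omega_r,\beta,V_w)-\max\Big\{\hat g+\alpha\ln\frac{\omega_r}{\omega_{rd}},\,0\Big\}\Big),\qquad \dot{\hat g}=\frac hJ\big(g(\omega_r,\beta,V_w)-\hat g\big),$$ where $\omega_{rd}$ is a constant with $0<\omega_{rd}\le\omega_r^{(1)}$, and $\alpha,h\in\mathbb{R}$ are gains. Let $D=\{(\omega_r,\hat g):0<\omega_r\le\omega_r^{(1)},\ \hat g\in\mathbb{R}\}\subset\mathbb{R}^2$. If $\alpha>0$ and $$h>\overline{\gamma}\ \text{ if }\ \overline{\gamma}\ge-\tfrac13\underline{\gamma},\qquad h>-\frac{(\overline{\gamma}-\underline{\gamma})^2}{8(\underline{\gamma}+\overline{\gamma})}\ \text{ otherwise},$$ then: (i) the system has a unique equilibrium point in $D$, namely $(\omega_{rd},g(\omega_{rd},\beta,V_w))$; (ii) $D$ is positively invariant, i.e., if $(\omega_r(0),\hat g(0))\in D$ then $(\omega_r(t),\hat g(t))\in D$ for all $t\ge0$; and (iii) the equilibrium point $(\omega_{rd},g(\omega_{rd},\beta,V_w))$ is locally asymptotically stable with domain of attraction $D$.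
   Context: This models a wind turbine rotor: $\omega_r$ is the rotor angular velocity, $\omega_{rd}$ its desired value, $\hat g$ an estimate of the lumped uncertainty $g$, $J$ the moment of inertia, $C_f$ the friction coefficient, $\rho$ the air density, $A=\pi R^2$ the swept area of blades of radius $R$, $V_w$ the wind speed, $\beta$ the blade pitch angle, and $C_p(\lambda,\beta)$ the performance coefficient as a function of tip speed ratio $\lambda=\omega_r R/V_w$ and pitch. The constant $a'$ equals $-\frac{v_{ds}^2+v_{qs}^2}{4\omega_s R_s}$ for electrical parameters with $\omega_s,R_s>0$ and $(v_{ds},v_{qs})\neq(0,0)$, hence is negative. The paper asserts that under (A1)–(A4) a point $\omega_r^{(1)}$ and constants $\underline\gamma,\overline\gamma$ as described exist. *)

(* Defs.v *)
From Stdlib Require Import Reals Lra.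
From Coquelicot Require Import Coquelicot.
Open Scope R_scope.

Definition gfun (rho A Rad Cf a' : R) (Cp : R -> R -> R) (beta Vw : R) (w : R) : R :=
  (1/2 * rho * A * Cp (w * Rad / Vw) beta * Vw ^ 3) / w - a' - Cf * w.

Definition rhs_w (J alpha wrd : R) (g : R -> R) (w gh : R) : R :=
  (g w - Rmax (gh + alpha * ln (w / wrd)) 0) / J.

Definition rhs_g (J h : R) (g : R -> R) (w gh : R) : R :=
  h / J * (g w - gh).

(* (w, gh) is a solution on [0, +oo) of  w' = F1 w gh,  gh' = F2 w gh :
   w stays in the domain w > 0 of the vector field, both components are
   right-continuous at 0 and differentiable with the prescribed derivative
   at every t > 0. *)
Definition is_solution (F1 F2 : R -> R -> R) (w gh : R -> R) : Prop :=
  (forall t, 0 <= t -> 0 < w t) /\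
  filterlim w (at_right 0) (locally (w 0)) /\
  filterlim gh (at_right 0) (locally (gh 0)) /\
  (forall t, 0 < t ->
     is_derive w t (F1 (w t) (gh t)) /\ is_derive gh t (F2 (w t) (gh t))).

Definition inD (w1 w gh : R) : Prop := 0 < w <= w1.

(* Main.v *)
Require Import Defs.
From Stdlib Require Import Reals Lra Lia.
From Coquelicot Require Import Coquelicot.
Open Scope R_scope.

(* Put [e = gh - g w], [y = alpha ln (w / wrd)] and [u = J w'].  The Lyapunov function
   [V = e^2 / 2 + k alpha (w ln (w / wrd) - w + wrd)] satisfies
   [J V' = - h e^2 - g'(w) e u + k y u].  Without saturation [u = - (e + y)] and [- J V'] is a
   quadratic form in [(e, y)], positive definite iff [(k + g'(w))^2 < 4 k h]; the best choice of
   [k] over the slopes in [[gl, gu]] yields the two cases of the gain condition.  Under saturation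
   [u = g w] lies between [0] and [- (e + y)], and [J V'] is affine in [u].  Hence [- J V'] is
   bounded below by a continuous function of the state that vanishes only at the equilibrium.

   The sublevel sets of [V] are not compact near [w = 0], but a trajectory cannot approach
   [w = 0]: [gh] is bounded above, so the control torque vanishes for small [w], where
   [J w' = g w >= 0].  A trajectory thus stays in a compact rectangle, on whose part [V >= eta] the
   derivative [V'] is bounded away from [0], and [V] tends to [0].  The same lower barrier allows
   truncating the field in [w] to a globally Lipschitz one, for which Picard iteration gives a
   global solution. *)

(** * Real functions *)

Lemma exp_le (x y : R) : x <= y -> exp x <= exp y.
Proof. intros [H| ->]; [left; now apply exp_increasing|lra]. Qed.

Lemma Rabs_increment_le (f df : R -> R) (a b D : R) :
  (forall c, Rmin a b <= c <= Rmax a b -> is_derive f c (df c) /\ Rabs (df c) <= D) ->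
  Rabs (f b - f a) <= D * Rabs (b - a).
Proof.
  intros Hf. destruct (MVT_abs f df a b) as [c [-> Hc]].
  - intros c Hc. now apply is_derive_Reals, Hf.
  - apply Rmult_le_compat_r; [apply Rabs_pos|now apply Hf].
Qed.

Lemma le_of_derive_sign (f df : R -> R) (v w : R) :
  (forall s, Rmin v w <= s <= Rmax v w -> is_derive f s (df s) /\ 0 <= df s * (s - v)) ->
  f v <= f w.
Proof.
  intros Hf. destruct (Rtotal_order v w) as [Hvw|[->|Hwv]]; [|lra|].
  - rewrite Rmin_left, Rmax_right in Hf by lra.
    destruct (MVT_cor2 f df v w Hvw) as [c [Heq Hc]].
    { intros c Hc. now apply is_derive_Reals, Hf. }
    destruct (Hf c) as [_ Hsign]; [lra|].
    assert (0 <= df c) by (apply Rmult_le_reg_r with (c - v); lra). nra.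
  - rewrite Rmin_right, Rmax_left in Hf by lra.
    destruct (MVT_cor2 f df w v Hwv) as [c [Heq Hc]].
    { intros c Hc. now apply is_derive_Reals, Hf. }
    destruct (Hf c) as [_ Hsign]; [lra|].
    assert (0 <= - df c) by (apply Rmult_le_reg_r with (v - c); lra). nra.
Qed.

Lemma is_derive_sqr_pos_part (x : R) :
  is_derive (fun y => Rmax y 0 ^ 2) x (2 * Rmax x 0).
Proof.
  apply is_derive_Reals. intros eps Heps. exists (mkposreal eps Heps).
  intros d Hd Hde. simpl in Hde. eapply Rle_lt_trans; [|exact Hde].
  assert (Hrem : Rabs (Rmax (x + d) 0 ^ 2 - Rmax x 0 ^ 2 - 2 * Rmax x 0 * d) <= Rabs d * Rabs d).
  { rewrite <- Rabs_mult, (Rabs_pos_eq (d * d)) by nra.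
    apply Rabs_le. unfold Rmax. repeat destruct Rle_dec; nra. }
  apply Rmult_le_reg_r with (Rabs d); [now apply Rabs_pos_lt|].
  rewrite <- Rabs_mult.
  replace (((Rmax (x + d) 0 ^ 2 - Rmax x 0 ^ 2) / d - 2 * Rmax x 0) * d)
    with (Rmax (x + d) 0 ^ 2 - Rmax x 0 ^ 2 - 2 * Rmax x 0 * d) by (field; exact Hd).
  exact Hrem.
Qed.

Definition clamp (a b x : R) : R := Rmax a (Rmin x b).

Lemma clamp_bounds (a b x : R) : a <= b -> a <= clamp a b x <= b.
Proof. intros Hab. split; [apply Rmax_l|]. apply Rmax_lub; [exact Hab|apply Rmin_r]. Qed.

Lemma clamp_id (a b x : R) : a <= x <= b -> clamp a b x = x.
Proof. intros Hx. unfold clamp. now rewrite Rmin_left, Rmax_right by lra. Qed.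

Lemma clamp_below (a b x : R) : a <= b -> x <= a -> clamp a b x = a.
Proof. intros Hab Hx. unfold clamp. now rewrite Rmin_left, Rmax_left by lra. Qed.

Lemma clamp_above (a b x : R) : a <= b -> b <= x -> clamp a b x = b.
Proof. intros Hab Hx. unfold clamp. now rewrite Rmin_right, Rmax_right by lra. Qed.

Lemma clamp_contraction (a b x y : R) : Rabs (clamp a b x - clamp a b y) <= Rabs (x - y).
Proof.
  unfold clamp, Rmax, Rmin. repeat destruct Rle_dec; unfold Rabs; repeat destruct Rcase_abs; lra.
Qed.

Lemma continuous_pos_lower_bound (f : R * R -> R) (a b a' b' : R) :
  (forall x y, a <= x <= b -> a' <= y <= b' -> continuous f (x, y) /\ 0 < f (x, y)) ->
  exists c, 0 < c /\ forall x y, a <= x <= b -> a' <= y <= b' -> c <= f (x, y).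
Proof.
  intros Hf.
  assert (radius : forall u v, {d : posreal | a <= u <= b -> a' <= v <= b' ->
    d <= f (u, v) / 2 /\
    forall x y, Rabs (x - u) < d -> Rabs (y - v) < d -> f (u, v) / 2 < f (x, y)}).
  { intros u v.
    destruct (Rle_dec a u); [|exists (mkposreal 1 Rlt_0_1); lra].
    destruct (Rle_dec u b); [|exists (mkposreal 1 Rlt_0_1); lra].
    destruct (Rle_dec a' v); [|exists (mkposreal 1 Rlt_0_1); lra].
    destruct (Rle_dec v b'); [|exists (mkposreal 1 Rlt_0_1); lra].
    destruct (Hf u v) as [Hcont Hpos]; [lra|lra|].
    assert (Hhalf : 0 < f (u, v) / 2) by lra.
    destruct (locally_2d_ex_dec (fun x y => f (u, v) / 2 < f (x, y)) u v) as [d Hd].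
    { intros x y. apply Rlt_or_not_lt. }
    { apply locally_2d_locally.
      generalize (proj1 (filterlim_locally f (f (u, v))) Hcont (mkposreal _ Hhalf)).
      apply filter_imp. intros [x y] Hxy. apply Rabs_lt_between' in Hxy. simpl in *. lra. }
    exists (mkposreal _ (Rmin_pos d (f (u, v) / 2) (cond_pos d) Hhalf)). intros _ _. simpl.
    split; [apply Rmin_r|]. intros x y Hx Hy.
    apply Hd; eapply Rlt_le_trans; eauto using Rmin_l. }
  destruct (compactness_value_2d a b a' b' (fun u v => proj1_sig (radius u v))) as [d Hd].
  exists d. split; [apply cond_pos|]. intros x y Hx Hy. apply Rnot_lt_le. intros Hlt.
  apply (Hd x y Hx Hy). intros [u [v [Hu [Hv [Hxu [Hyv Hduv]]]]]].
  destruct (radius u v) as [r Hr]. simpl in *. destruct (Hr Hu Hv) as [Hhalf Hnear].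
  specialize (Hnear x y Hxu Hyv). lra.
Qed.

Lemma Rabs_lt_of_sqr_lt (x e : R) : 0 < e -> x ^ 2 < e ^ 2 -> Rabs x < e.
Proof. intros He Hx. rewrite <- (Rabs_pos_eq e) by lra. apply Rsqr_lt_abs_0. unfold Rsqr. lra. Qed.

Lemma filterlim_of_sqr_le {T : Type} {F : (T -> Prop) -> Prop} {FF : Filter F}
  (f V : T -> R) (B l : R) :
  0 < B -> filterlim V F (locally 0) -> F (fun t => (f t - l) ^ 2 <= B * V t) ->
  filterlim f F (locally l).
Proof.
  intros HB HV Hf. apply filterlim_locally. intros [eps Heps].
  assert (Hr : 0 < eps ^ 2 / B) by (apply Rdiv_lt_0_compat; [now apply pow_lt|exact HB]).
  generalize (filter_and _ _ Hf (proj1 (filterlim_locally V 0) HV (mkposreal _ Hr))).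
  apply filter_imp. intros t [Hft HVt].
  apply Rabs_lt_between' in HVt. simpl in HVt.
  apply (Rabs_lt_of_sqr_lt (f t - l) eps Heps).
  eapply Rle_lt_trans; [exact Hft|].
  replace (eps ^ 2) with (B * (eps ^ 2 / B)) by (field; lra).
  apply Rmult_lt_compat_l; lra.
Qed.

(** * Differential inequalities on the half-line *)

Definition is_forward_derive (f df : R -> R) : Prop :=
  filterlim f (at_right 0) (locally (f 0)) /\ forall t, 0 < t -> is_derive f t (df t).

Lemma is_forward_derive_ext (f df dg : R -> R) :
  (forall t, 0 < t -> df t = dg t) -> is_forward_derive f df -> is_forward_derive f dg.
Proof.
  intros Heq [H0 Hd]. split; [exact H0|]. intros t Ht. rewrite <- Heq by exact Ht. now apply Hd.
Qed.

Lemma is_derive_forward (f df : R -> R) :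
  (forall t, is_derive f t (df t)) -> is_forward_derive f df.
Proof.
  intros Hd. split; [|intros t _; apply Hd].
  apply (filterlim_filter_le_1 f (filter_le_within _)).
  apply @ex_derive_continuous. eexists. apply Hd.
Qed.

Lemma is_forward_derive_comp (phi dphi f df : R -> R) :
  (forall t, 0 <= t -> is_derive phi (f t) (dphi (f t))) -> is_forward_derive f df ->
  is_forward_derive (fun t => phi (f t)) (fun t => dphi (f t) * df t).
Proof.
  intros Hphi [H0 Hd]. split.
  - apply (filterlim_comp _ _ _ f phi _ (locally (f 0))); [exact H0|].
    apply @ex_derive_continuous. eexists. apply Hphi. lra.
  - intros t Ht. rewrite Rmult_comm.
    apply (is_derive_comp phi f); [apply Hphi; lra|now apply Hd].
Qed.

Lemma is_forward_derive_plus (f df g dg : R -> R) :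
  is_forward_derive f df -> is_forward_derive g dg ->
  is_forward_derive (fun t => f t + g t) (fun t => df t + dg t).
Proof.
  intros [Hf0 Hf] [Hg0 Hg]. split.
  - apply (filterlim_comp_2 _ _ Rplus Hf0 Hg0). exact (filterlim_plus (f 0) (g 0)).
  - intros t Ht. apply @is_derive_plus; auto.
Qed.

Lemma is_forward_derive_mult (f df g dg : R -> R) :
  is_forward_derive f df -> is_forward_derive g dg ->
  is_forward_derive (fun t => f t * g t) (fun t => df t * g t + f t * dg t).
Proof.
  intros [Hf0 Hf] [Hg0 Hg]. split.
  - apply (filterlim_comp_2 _ _ Rmult Hf0 Hg0). exact (filterlim_mult (f 0) (g 0)).
  - intros t Ht. apply (is_derive_mult f g); auto. exact Rmult_comm.
Qed.

Lemma forward_nonincreasing (f df : R -> R) (s t : R) :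
  is_forward_derive f df -> 0 <= s <= t -> (forall r, s < r < t -> df r <= 0) -> f t <= f s.
Proof.
  intros [H0 Hd] Hst Hn.
  assert (interior : forall r, 0 < r -> s <= r < t -> f t <= f r).
  { intros r Hr Hrt.
    destruct (MVT_cor2 f df r t) as [c [Heq Hc]]; [lra| |].
    - intros c Hc. apply is_derive_Reals, Hd. lra.
    - pose proof (Hn c ltac:(lra)). nra. }
  destruct (Req_dec s t) as [->|Hne]; [lra|].
  destruct (Req_dec s 0) as [->|Hs]; [|apply interior; lra].
  apply (filterlim_le (F := at_right 0) (fun _ => f t) f (Finite (f t)) (Finite (f 0)));
    [|apply filterlim_const|exact H0].
  exists (mkposreal t ltac:(lra)). intros r Hr Hr0. apply Rabs_lt_between' in Hr.
  simpl in Hr. apply interior; lra.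
Qed.

(* [exp (- 2 K t) max (f t - m, 0)^2] is differentiable and nonincreasing. *)
Lemma barrier_above (f df : R -> R) (K m : R) :
  is_forward_derive f df -> f 0 <= m ->
  (forall t, 0 < t -> m < f t -> df t <= K * (f t - m)) ->
  forall t, 0 <= t -> f t <= m.
Proof.
  intros Hf Hm Hgrowth t Ht.
  set (excess := fun s => Rmax (f s - m) 0).
  assert (Hsqr : is_forward_derive (fun s => excess s ^ 2) (fun s => 2 * excess s * df s)).
  { apply (is_forward_derive_comp (fun x => Rmax (x - m) 0 ^ 2) (fun x => 2 * Rmax (x - m) 0));
      [|exact Hf].
    intros s _.
    replace (2 * Rmax (f s - m) 0) with (scal 1 (2 * Rmax (f s - m) 0)) by apply Rmult_1_l.
    apply (is_derive_comp (fun y => Rmax y 0 ^ 2) (fun x => x - m));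
      [apply is_derive_sqr_pos_part|auto_derive; [easy|ring]]. }
  assert (Hexp : is_forward_derive (fun s => exp (-2 * K * s))
    (fun s => -2 * K * exp (-2 * K * s))).
  { apply is_derive_forward. intros s. auto_derive; [easy|ring]. }
  assert (Hdecr : exp (-2 * K * t) * excess t ^ 2 <= exp (-2 * K * 0) * excess 0 ^ 2).
  { apply (forward_nonincreasing _ _ 0 t (is_forward_derive_mult _ _ _ _ Hexp Hsqr)); [lra|].
    intros s Hs. pose proof (exp_pos (-2 * K * s)).
    enough (excess s * df s <= excess s * (K * excess s)) by nra.
    unfold excess, Rmax. destruct Rle_dec; [lra|].
    apply Rmult_le_compat_l; [lra|]. apply Hgrowth; lra. }
  assert (Hinit : excess 0 = 0) by (apply Rmax_right; lra).
  rewrite Hinit in Hdecr. pose proof (exp_pos (-2 * K * t)).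
  assert (excess t ^ 2 <= 0) by nra.
  pose proof (Rmax_l (f t - m) 0). pose proof (Rmax_r (f t - m) 0). fold (excess t) in *. nra.
Qed.

Lemma barrier_below (f df : R -> R) (K m : R) :
  is_forward_derive f df -> m <= f 0 ->
  (forall t, 0 < t -> f t < m -> K * (f t - m) <= df t) ->
  forall t, 0 <= t -> m <= f t.
Proof.
  intros Hf Hm Hgrowth t Ht.
  enough (- f t <= - m) by lra.
  apply (barrier_above (fun s => - f s) (fun s => -1 * df s) K (- m)); [|lra| |exact Ht].
  - apply (is_forward_derive_comp Ropp (fun _ => -1)); [|exact Hf].
    intros s _. auto_derive; [easy|ring].
  - intros s Hs Hlt. pose proof (Hgrowth s Hs ltac:(lra)). lra.
Qed.

Lemma lyapunov_vanishes (V dV : R -> R) :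
  is_forward_derive V dV ->
  (forall t, 0 <= t -> 0 <= V t) ->
  (forall t, 0 < t -> dV t <= 0) ->
  (forall eta, 0 < eta -> exists c, 0 < c /\ forall t, 0 < t -> eta <= V t -> dV t <= - c) ->
  filterlim V (Rbar_locally p_infty) (locally 0).
Proof.
  intros HV Hpos Hdecr Hrate. apply filterlim_locally. intros [eta Heta].
  destruct (Hrate eta Heta) as [c [Hc Hdrop]].
  exists (V 0 / c). intros t Ht.
  assert (HV0 : 0 <= V 0 / c) by (apply Rdiv_le_0_compat; [apply Hpos|]; lra).
  assert (Hsmall : V t < eta).
  { apply Rnot_le_lt. intros Hge.
    assert (Hline : is_forward_derive (fun s => c * s) (fun _ => c)).
    { apply is_derive_forward. intros s. auto_derive; [easy|ring]. }
    assert (V t + c * t <= V 0 + c * 0).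
    { apply (forward_nonincreasing _ _ 0 t (is_forward_derive_plus _ _ _ _ HV Hline)); [lra|].
      intros s Hs. enough (dV s <= - c) by lra.
      apply Hdrop; [lra|]. apply Rle_trans with (V t); [exact Hge|].
      apply (forward_nonincreasing V dV s t HV); [lra|]. intros r Hr. apply Hdecr. lra. }
    assert (V 0 < c * t).
    { replace (V 0) with (c * (V 0 / c)) by (field; lra). now apply Rmult_lt_compat_l. }
    pose proof (Hpos t ltac:(lra)). lra. }
  apply Rabs_lt_between'. simpl. pose proof (Hpos t ltac:(lra)). lra.
Qed.

(** * Lipschitz maps *)

Definition norm_dist {V : NormedModule R_AbsRing} (x y : V) : R := norm (minus x y).

Lemma norm_dist_pos {V : NormedModule R_AbsRing} (x y : V) : 0 <= norm_dist x y.
Proof. exact (norm_ge_0 (minus x y)). Qed.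

Lemma norm_dist_refl {V : NormedModule R_AbsRing} (x : V) : norm_dist x x = 0.
Proof. unfold norm_dist. rewrite (minus_eq_zero x). exact norm_zero. Qed.

Lemma norm_dist_sym {V : NormedModule R_AbsRing} (x y : V) : norm_dist x y = norm_dist y x.
Proof. unfold norm_dist. rewrite <- (opp_minus x y). symmetry. exact (norm_opp (minus x y)). Qed.

Lemma norm_dist_triangle {V : NormedModule R_AbsRing} (y x z : V) :
  norm_dist x z <= norm_dist x y + norm_dist y z.
Proof. unfold norm_dist. rewrite (minus_trans y x z). exact (norm_triangle _ _). Qed.

Lemma norm_dist_plus_l {V : NormedModule R_AbsRing} (a x y : V) :
  norm_dist (plus a x) (plus a y) = norm_dist x y.
Proof.
  assert (cancel : forall (G : AbelianGroup) (a x y : G),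
    minus (plus a x) (plus a y) = minus x y).
  { clear. intros G a x y. unfold minus.
    now rewrite opp_plus, (plus_comm a x), <- plus_assoc, (plus_assoc a), plus_opp_r, plus_zero_l. }
  unfold norm_dist. f_equal. exact (cancel V a x y).
Qed.

Lemma norm_dist_plus_self {V : NormedModule R_AbsRing} (a x : V) :
  norm_dist (plus a x) a = norm x.
Proof.
  rewrite <- (plus_zero_r a) at 2. rewrite (norm_dist_plus_l a x zero).
  unfold norm_dist. f_equal. exact (minus_zero_r x).
Qed.

Lemma continuous_norm_dist {V : NormedModule R_AbsRing} (x y : V) :
  continuous (norm_dist x) y.
Proof.
  apply (continuous_comp (fun z => minus x z) norm); [|exact (filterlim_norm _)].
  apply @continuous_minus; [apply continuous_const|apply continuous_id].
Qed.

Lemma norm_dist_R (x y : R) : norm_dist x y = Rabs (x - y).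
Proof. reflexivity. Qed.

Definition lipschitz {U V : NormedModule R_AbsRing} (f : U -> V) : Prop :=
  exists L, 0 < L /\ forall x y, norm_dist (f x) (f y) <= L * norm_dist x y.

Lemma lipschitz_continuous {U V : NormedModule R_AbsRing} (f : U -> V) (x : U) :
  lipschitz f -> continuous f x.
Proof.
  intros [L [HL Hf]]. apply filterlim_locally_ball_norm. intros [eps Heps].
  apply locally_le_locally_norm.
  assert (Hr : 0 < eps / L) by (now apply Rdiv_lt_0_compat).
  exists (mkposreal _ Hr). intros y Hy.
  apply Rle_lt_trans with (L * norm_dist y x); [apply Hf|].
  replace eps with (L * (eps / L)) by (field; lra). now apply Rmult_lt_compat_l.
Qed.

Lemma lipschitz_comp {U V W : NormedModule R_AbsRing} (f : U -> V) (g : V -> W) :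
  lipschitz f -> lipschitz g -> lipschitz (fun x => g (f x)).
Proof.
  intros [Lf [HLf Hf]] [Lg [HLg Hg]]. exists (Lg * Lf). split; [now apply Rmult_lt_0_compat|].
  intros x y. eapply Rle_trans; [apply Hg|]. rewrite Rmult_assoc.
  apply Rmult_le_compat_l; [lra|apply Hf].
Qed.

Lemma lipschitz_linear {U V : NormedModule R_AbsRing} (l : U -> V) : is_linear l -> lipschitz l.
Proof.
  intros Hl. destruct (linear_norm l Hl) as [M [HM Hbound]].
  exists M. split; [exact HM|]. intros x y.
  unfold norm_dist. rewrite <- (linear_minus l x y Hl). apply Hbound.
Qed.

Lemma lipschitz_pair {U V W : NormedModule R_AbsRing} (f : U -> V) (g : U -> W) :
  lipschitz f -> lipschitz g -> lipschitz (fun x => (f x, g x)).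
Proof.
  intros [Lf [HLf Hf]] [Lg [HLg Hg]].
  assert (Hsqrt : 0 < sqrt 2) by (apply sqrt_lt_R0; lra).
  exists (sqrt 2 * (Lf + Lg)). split; [apply Rmult_lt_0_compat; lra|]. intros x y.
  eapply Rle_trans; [apply (norm_prod (minus (f x) (f y)) (minus (g x) (g y)))|].
  rewrite Rmult_assoc. apply Rmult_le_compat_l; [lra|].
  pose proof (norm_dist_pos x y). pose proof (Hf x y). pose proof (Hg x y).
  unfold norm_dist in *.
  apply Rmax_lub; nra.
Qed.

Lemma lipschitz_plus {U V : NormedModule R_AbsRing} (f g : U -> V) :
  lipschitz f -> lipschitz g -> lipschitz (fun x => plus (f x) (g x)).
Proof.
  intros Hf Hg. apply (lipschitz_comp (fun x => (f x, g x)) (fun p => plus (fst p) (snd p))).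
  - now apply lipschitz_pair.
  - apply lipschitz_linear, is_linear_plus.
Qed.

Lemma lipschitz_opp {U V : NormedModule R_AbsRing} (f : U -> V) :
  lipschitz f -> lipschitz (fun x => opp (f x)).
Proof. intros Hf. apply (lipschitz_comp f opp Hf), lipschitz_linear, is_linear_opp. Qed.

Lemma lipschitz_pos_part : lipschitz (fun x : R => Rmax x 0).
Proof.
  exists 1. split; [lra|]. intros x y. rewrite !norm_dist_R.
  unfold Rmax. repeat destruct Rle_dec; unfold Rabs; repeat destruct Rcase_abs; lra.
Qed.

Lemma lipschitz_clamp (f df : R -> R) (a b D : R) :
  a <= b -> (forall c, a <= c <= b -> is_derive f c (df c) /\ Rabs (df c) <= D) ->
  lipschitz (fun x => f (clamp a b x)).
Proof.
  intros Hab Hf.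
  assert (HD : 0 <= D).
  { destruct (Hf a) as [_ Hle]; [lra|]. pose proof (Rabs_pos (df a)). lra. }
  exists (D + 1). split; [lra|]. intros x y.
  pose proof (clamp_bounds a b x Hab). pose proof (clamp_bounds a b y Hab).
  apply Rle_trans with (D * Rabs (clamp a b x - clamp a b y)).
  - apply (Rabs_increment_le f df). intros c Hc. apply Hf. split.
    + eapply Rle_trans; [|apply Hc]. apply Rmin_glb; lra.
    + eapply Rle_trans; [apply Hc|]. apply Rmax_lub; lra.
  - pose proof (clamp_contraction a b x y). pose proof (Rabs_pos (clamp a b x - clamp a b y)).
    rewrite (norm_dist_R x y). nra.
Qed.

(** * Completeness of products *)

Section ProductComplete.

Variables U V : CompleteSpace.

Definition prod_lim (F : (U * V -> Prop) -> Prop) : U * V :=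
  (lim (filtermap fst F), lim (filtermap snd F)).

Lemma prod_complete_cauchy (F : (U * V -> Prop) -> Prop) :
  ProperFilter F -> cauchy F -> forall eps : posreal, F (ball (prod_lim F) eps).
Proof.
  intros HF Hcauchy eps.
  assert (HU : F (fun p => ball (lim (filtermap fst F)) eps (fst p))).
  { apply (complete_cauchy (filtermap fst F)); [now apply filtermap_proper_filter|].
    intros e. destruct (Hcauchy e) as [[x y] Hxy]. exists x.
    refine (filter_imp (ball (x, y) e) _ _ Hxy). now intros p [Hp _]. }
  assert (HV : F (fun p => ball (lim (filtermap snd F)) eps (snd p))).
  { apply (complete_cauchy (filtermap snd F)); [now apply filtermap_proper_filter|].
    intros e. destruct (Hcauchy e) as [[x y] Hxy]. exists y.
    refine (filter_imp (ball (x, y) e) _ _ Hxy). now intros p [_ Hp]. }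
  exact (filter_and _ _ HU HV).
Qed.

Lemma close_prod_lim (F G : (U * V -> Prop) -> Prop) :
  filter_le F G -> filter_le G F -> close (prod_lim F) (prod_lim G).
Proof.
  intros HFG HGF eps. split; apply close_lim; intros P; [apply HFG|apply HGF|apply HFG|apply HGF].
Qed.

Definition prod_CompleteSpace_mixin : CompleteSpace.mixin_of (prod_UniformSpace U V) :=
  CompleteSpace.Mixin (prod_UniformSpace U V) prod_lim prod_complete_cauchy close_prod_lim.

End ProductComplete.

Definition prod_CompleteNormedModule (U V : CompleteNormedModule R_AbsRing) :
    CompleteNormedModule R_AbsRing :=
  CompleteNormedModule.Pack R_AbsRing (U * V)
    (CompleteNormedModule.Class _ _ (NormedModule.class _ (prod_NormedModule R_AbsRing U V))
       (prod_CompleteSpace_mixin U V)) (U * V).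
Canonical prod_CompleteNormedModule.

Lemma is_derive_fst {U V : NormedModule R_AbsRing} (p : R -> U * V) (t : R) (l : U * V) :
  is_derive p t l -> is_derive (fun s => fst (p s)) t (fst l).
Proof.
  intros Hp. exact (filterdiff_comp' _ _ _ _ _ Hp (filterdiff_linear _ is_linear_fst)).
Qed.

Lemma is_derive_snd {U V : NormedModule R_AbsRing} (p : R -> U * V) (t : R) (l : U * V) :
  is_derive p t l -> is_derive (fun s => snd (p s)) t (snd l).
Proof.
  intros Hp. exact (filterdiff_comp' _ _ _ _ _ Hp (filterdiff_linear _ is_linear_snd)).
Qed.

(** * Picard iteration *)

Lemma geometric_tail {V : NormedModule R_AbsRing} (u : nat -> V) (C r : R) :
  0 <= r < 1 -> (forall n, norm_dist (u (S n)) (u n) <= C * r ^ n) ->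
  forall n m, (n <= m)%nat -> norm_dist (u n) (u m) <= C / (1 - r) * r ^ n.
Proof.
  intros Hr Hu n m Hnm.
  assert (HC : 0 <= C / (1 - r)).
  { apply Rdiv_le_0_compat; [|lra]. pose proof (norm_dist_pos (u 1%nat) (u 0%nat)).
    pose proof (Hu 0%nat) as H0. rewrite pow_O in H0. lra. }
  enough (norm_dist (u n) (u m) <= C / (1 - r) * r ^ n - C / (1 - r) * r ^ m).
  { pose proof (Rmult_le_pos _ _ HC (pow_le r m (proj1 Hr))). lra. }
  induction Hnm as [|m Hnm IH].
  - rewrite norm_dist_refl. lra.
  - pose proof (norm_dist_triangle (u m) (u n) (u (S m))).
    pose proof (Hu m) as Hm. rewrite norm_dist_sym in Hm.
    replace (C / (1 - r) * r ^ S m) with (C / (1 - r) * r ^ m - C * r ^ m)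
      by (simpl; field; lra).
    lra.
Qed.

Lemma is_lim_seq_scal_geom (C r : R) : 0 <= r < 1 -> is_lim_seq (fun n => C * r ^ n) 0.
Proof.
  intros Hr. replace (Finite 0) with (Rbar_mult C 0) by (simpl; now rewrite Rmult_0_r).
  apply is_lim_seq_scal_l, is_lim_seq_geom. rewrite Rabs_pos_eq; lra.
Qed.

Lemma filterlim_of_geometric_bound {V : NormedModule R_AbsRing} (u : nat -> V) (l : V) (C r : R) :
  0 <= r < 1 -> (forall n, norm_dist (u n) l <= C * r ^ n) -> filterlim u eventually (locally l).
Proof.
  intros Hr Hu. apply filterlim_locally_ball_norm. intros eps.
  destruct (proj2 (is_lim_seq_spec _ _) (is_lim_seq_scal_geom C r Hr) eps) as [N HN].
  exists N. intros n Hn. apply Rle_lt_trans with (C * r ^ n); [apply Hu|].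
  specialize (HN n Hn). rewrite Rminus_0_r in HN. now apply Rabs_def2 in HN.
Qed.

Lemma geometric_lim {V : CompleteNormedModule R_AbsRing} (u : nat -> V) (C r : R) :
  0 <= r < 1 -> (forall n, norm_dist (u (S n)) (u n) <= C * r ^ n) ->
  forall n, norm_dist (u n) (lim (filtermap u eventually)) <= C / (1 - r) * r ^ n.
Proof.
  intros Hr Hu n. set (l := lim (filtermap u eventually)).
  assert (Hlim : filterlim u eventually (locally l)).
  { apply filterlim_locally. intros eps.
    apply (complete_cauchy (filtermap u eventually));
      [apply filtermap_proper_filter, eventually_filter|].
    intros e.
    destruct (proj2 (is_lim_seq_spec _ _) (is_lim_seq_scal_geom (C / (1 - r)) r Hr) e) as [N HN].
    exists (u N), N. intros m Hm. apply (norm_compat1 (u N) (u m) e).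
    change (norm_dist (u m) (u N) < e). rewrite norm_dist_sym.
    eapply Rle_lt_trans; [now apply (geometric_tail u C r Hr Hu)|].
    specialize (HN N (le_n N)). rewrite Rminus_0_r in HN. now apply Rabs_def2 in HN. }
  apply (filterlim_le (F := eventually) (fun m => norm_dist (u n) (u m))
    (fun _ => C / (1 - r) * r ^ n) (Finite _) (Finite _)); [|..|apply filterlim_const].
  - exists n. intros m. now apply geometric_tail.
  - exact (filterlim_comp _ _ _ _ _ _ _ _ Hlim (continuous_norm_dist (u n) l)).
Qed.

Lemma is_RInt_exp (c K t : R) : K <> 0 ->
  is_RInt (fun s => c * exp (K * s)) 0 t (c / K * exp (K * t) - c / K).
Proof.
  intros HK.
  replace (c / K * exp (K * t) - c / K)
    with (minus (c / K * exp (K * t)) (c / K * exp (K * 0)))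
    by (unfold minus, plus, opp; simpl; rewrite Rmult_0_r, exp_0; ring).
  apply (is_RInt_derive (fun s => c / K * exp (K * s))).
  - intros s _. auto_derive; [easy|]. now field.
  - intros s _. apply @ex_derive_continuous. auto_derive. easy.
Qed.

Lemma norm_RInt_le_exp {V : CompleteNormedModule R_AbsRing} (f : R -> V) (c K t : R) :
  0 <= c -> 0 < K -> (forall s, continuous f s) ->
  (forall s, norm (f s) <= c * exp (K * Rabs s)) ->
  norm (RInt f 0 t) <= c / K * exp (K * Rabs t).
Proof.
  intros Hc HK.
  assert (forward : forall f t, 0 <= t -> (forall s, continuous f s) ->
    (forall s, norm (f s) <= c * exp (K * Rabs s)) ->
    norm (RInt f 0 t : V) <= c / K * exp (K * Rabs t)).
  { clear f t. intros f t Ht Hcont Hf. rewrite Rabs_pos_eq by exact Ht.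
    apply Rle_trans with (c / K * exp (K * t) - c / K).
    - apply (norm_RInt_le f (fun s => c * exp (K * s)) 0 t _ _ Ht).
      + intros s Hs. rewrite <- (Rabs_pos_eq s) at 2 by lra. apply Hf.
      + apply @RInt_correct, @ex_RInt_continuous. intros s _. apply Hcont.
      + apply is_RInt_exp. lra.
    - pose proof (Rdiv_le_0_compat c K Hc HK). lra. }
  intros Hcont Hf. destruct (Rle_lt_dec 0 t) as [Ht|Ht]; [now apply forward|].
  assert (Hrefl : is_RInt (fun s => opp (f (- s))) 0 (- t) (RInt f 0 t)).
  { apply (is_RInt_comp_opp f 0 (- t) (RInt f 0 t)). rewrite Ropp_0, Ropp_involutive.
    apply @RInt_correct, @ex_RInt_continuous. intros s _. apply Hcont. }
  rewrite <- (is_RInt_unique _ _ _ _ Hrefl), <- Rabs_Ropp. apply forward; [lra| |].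
  - intros s. apply @continuous_opp. apply (continuous_comp Ropp f); [|apply Hcont].
    apply @continuous_opp, continuous_id.
  - intros s. rewrite <- (Rabs_Ropp s).
    apply Rle_trans with (norm (f (- s))); [right; exact (norm_opp (f (- s)))|apply Hf].
Qed.

Lemma continuous_of_locally_uniform_lim {U : UniformSpace} {V : NormedModule R_AbsRing}
  (u : nat -> U -> V) (f : U -> V) (x : U) :
  (forall n, continuous (u n) x) ->
  (forall eps, 0 < eps -> exists n, locally x (fun y => norm_dist (u n y) (f y) < eps)) ->
  continuous f x.
Proof.
  intros Hu Hunif. apply filterlim_locally_ball_norm. intros [eps Heps].
  assert (H3 : 0 < eps / 3) by lra.
  destruct (Hunif (eps / 3) H3) as [n Hn].
  pose proof (proj1 (filterlim_locally_ball_norm _ _) (Hu n) (mkposreal _ H3)) as Hcont.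
  generalize (filter_and _ _ Hn Hcont). apply filter_imp. intros y [Hy Hyx].
  change (norm_dist (u n y) (u n x) < eps / 3) in Hyx. change (norm_dist (f y) (f x) < eps).
  pose proof (locally_singleton x _ Hn) as Hx. rewrite norm_dist_sym in Hy.
  pose proof (norm_dist_triangle (u n y) (f y) (f x)).
  pose proof (norm_dist_triangle (u n x) (u n y) (f x)). lra.
Qed.

Section PicardLindelof.

Variable V : CompleteNormedModule R_AbsRing.
Variable F : V -> V.
Variable L : R.
Hypothesis L_pos : 0 < L.
Hypothesis F_lipschitz : forall x y, norm_dist (F x) (F y) <= L * norm_dist x y.
Variable a : V.

Definition picard_step (x : R -> V) (t : R) : V := plus a (RInt (fun s => F (x s)) 0 t).

Lemma continuous_field (x : R -> V) :
  (forall s, continuous x s) -> forall s, continuous (fun r => F (x r)) s.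
Proof.
  intros Hx s. apply (continuous_comp x F); [apply Hx|].
  exact (lipschitz_continuous F (x s) (ex_intro _ L (conj L_pos F_lipschitz))).
Qed.

Lemma is_derive_picard_step (x : R -> V) (t : R) :
  (forall s, continuous x s) -> is_derive (picard_step x) t (F (x t)).
Proof.
  intros Hx. pose proof (continuous_field x Hx) as HFx.
  rewrite <- (plus_zero_l (F (x t))).
  apply @is_derive_plus; [apply @is_derive_const|].
  apply (is_derive_RInt (fun s => F (x s)) (fun u => RInt (fun s => F (x s)) 0 u) 0); [|apply HFx].
  apply filter_forall. intros u. apply @RInt_correct, @ex_RInt_continuous. intros s _. apply HFx.
Qed.

(* The weight [exp (2 L |t|)] makes the contraction global in time. *)
Lemma picard_step_contraction (x y : R -> V) (M t : R) :
  (forall s, continuous x s) -> (forall s, continuous y s) -> 0 <= M ->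
  (forall s, norm_dist (x s) (y s) <= M * exp (2 * L * Rabs s)) ->
  norm_dist (picard_step x t) (picard_step y t) <= M / 2 * exp (2 * L * Rabs t).
Proof.
  intros Hx Hy HM Hxy.
  pose proof (continuous_field x Hx) as HFx. pose proof (continuous_field y Hy) as HFy.
  apply Rle_trans with (norm (RInt (fun s => minus (F (x s)) (F (y s))) 0 t)).
  { right. eapply eq_trans; [exact (norm_dist_plus_l a _ _)|].
    symmetry. apply (f_equal norm), RInt_minus; apply @ex_RInt_continuous; auto. }
  replace (M / 2) with (L * M / (2 * L)) by (field; lra).
  apply norm_RInt_le_exp; [nra|lra| |].
  - intros s. exact (continuous_minus _ _ s (HFx s) (HFy s)).
  - intros s. apply Rle_trans with (L * norm_dist (x s) (y s)); [apply F_lipschitz|].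
    rewrite Rmult_assoc. apply Rmult_le_compat_l; [lra|apply Hxy].
Qed.

Fixpoint picard (n : nat) : R -> V :=
  match n with
  | O => fun _ => a
  | S n => picard_step (picard n)
  end.

Definition picard_limit (t : R) : V := lim (filtermap (fun n => picard n t) eventually).

Lemma continuous_picard (n : nat) (t : R) : continuous (picard n) t.
Proof.
  revert t. induction n as [|n IH]; intros t; [apply continuous_const|].
  apply @ex_derive_continuous. eexists. now apply is_derive_picard_step.
Qed.

Lemma picard_increment (n : nat) (t : R) :
  norm_dist (picard (S n) t) (picard n t)
    <= norm (F a) / (2 * L) * (1 / 2) ^ n * exp (2 * L * Rabs t).
Proof.
  assert (HM : 0 <= norm (F a) / (2 * L)) by (apply Rdiv_le_0_compat; [apply norm_ge_0|lra]).
  revert t. induction n as [|n IH]; intros t.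
  - rewrite pow_O, Rmult_1_r. eapply Rle_trans; [right; exact (norm_dist_plus_self a _)|].
    apply norm_RInt_le_exp; [apply norm_ge_0|lra|intros s; apply continuous_const|].
    intros s. rewrite <- (Rmult_1_r (norm (F a))) at 1.
    apply Rmult_le_compat_l; [apply norm_ge_0|].
    pose proof (exp_ineq1_le (2 * L * Rabs s)). pose proof (Rabs_pos s). nra.
  - replace (norm (F a) / (2 * L) * (1 / 2) ^ S n) with (norm (F a) / (2 * L) * (1 / 2) ^ n / 2)
      by (simpl; field; lra).
    apply (picard_step_contraction (picard (S n)) (picard n));
      [apply continuous_picard|apply continuous_picard| |exact IH].
    apply Rmult_le_pos; [exact HM|apply pow_le; lra].
Qed.

Lemma picard_error (n : nat) (t : R) :
  norm_dist (picard n t) (picard_limit t) <= norm (F a) / L * exp (2 * L * Rabs t) * (1 / 2) ^ n.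
Proof.
  replace (norm (F a) / L * exp (2 * L * Rabs t))
    with (norm (F a) / (2 * L) * exp (2 * L * Rabs t) / (1 - 1 / 2)) by (field; lra).
  apply (geometric_lim (fun n => picard n t)); [lra|]. intros m.
  eapply Rle_trans; [apply picard_increment|]. right. ring.
Qed.

Lemma continuous_picard_limit (t : R) : continuous picard_limit t.
Proof.
  apply (continuous_of_locally_uniform_lim picard); [intros n; apply continuous_picard|].
  intros eps Heps.
  set (E := norm (F a) / L * exp (2 * L * (Rabs t + 1))).
  destruct (proj2 (is_lim_seq_spec _ _) (is_lim_seq_scal_geom E (1 / 2) ltac:(lra))
    (mkposreal eps Heps)) as [n Hn].
  specialize (Hn n (le_n n)). simpl in Hn. rewrite Rminus_0_r in Hn. apply Rabs_def2 in Hn.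
  exists n, (mkposreal 1 Rlt_0_1). intros s Hs.
  eapply Rle_lt_trans; [apply picard_error|]. eapply Rle_lt_trans; [|apply Hn].
  apply Rmult_le_compat_r; [apply pow_le; lra|].
  apply Rmult_le_compat_l; [apply Rdiv_le_0_compat; [apply norm_ge_0|exact L_pos]|].
  apply exp_le, Rmult_le_compat_l; [lra|].
  pose proof (Rabs_triang_inv s t). change (Rabs (s - t) < 1) in Hs. lra.
Qed.

Lemma picard_limit_fixed (t : R) : picard_limit t = picard_step picard_limit t.
Proof.
  set (C := norm (F a) / L).
  assert (HC : 0 <= C) by (apply Rdiv_le_0_compat; [apply norm_ge_0|exact L_pos]).
  apply (filterlim_locally_unique (F := eventually) (fun n => picard (S n) t));
    apply (filterlim_of_geometric_bound _ _ (C * exp (2 * L * Rabs t) / 2) (1 / 2)); try lra;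
    intros n.
  - eapply Rle_trans; [apply picard_error|]. right. unfold C. simpl. field. lra.
  - apply Rle_trans with (C * (1 / 2) ^ n / 2 * exp (2 * L * Rabs t)); [|right; field].
    apply picard_step_contraction; [apply continuous_picard|apply continuous_picard_limit| |].
    + apply Rmult_le_pos; [exact HC|apply pow_le; lra].
    + intros s. eapply Rle_trans; [apply picard_error|]. right. unfold C. ring.
Qed.

End PicardLindelof.

Theorem picard_lindelof {V : CompleteNormedModule R_AbsRing} (F : V -> V) (a : V) :
  lipschitz F -> exists x : R -> V, x 0 = a /\ forall t, is_derive x t (F (x t)).
Proof.
  intros [L [HL HF]]. exists (picard_limit V F a). split.
  - rewrite (picard_limit_fixed V F L HL HF a 0). unfold picard_step.
    rewrite RInt_point. apply plus_zero_r.
  - intros t. apply (is_derive_ext (picard_step V F a (picard_limit V F a))).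
    + intros s. symmetry. now apply picard_limit_fixed with L.
    + apply (is_derive_picard_step V F L HL HF).
      intros s. now apply continuous_picard_limit with L.
Qed.

(** * Gain condition and dissipation rate *)

Lemma quadratic_form_coercive (a b c : R) :
  0 < c -> b ^ 2 < 4 * a * c ->
  exists q, 0 < q /\ forall x y, q * (x ^ 2 + y ^ 2) <= a * x ^ 2 + b * x * y + c * y ^ 2.
Proof.
  intros Hc Hdisc. pose proof (pow2_ge_0 b) as Hb.
  assert (Ha : 0 < a) by (apply Rnot_le_lt; intros Hle; nra).
  set (q := (4 * a * c - b ^ 2) / (4 * (a + c))).
  assert (Hq : q * (4 * (a + c)) = 4 * a * c - b ^ 2) by (unfold q; field; lra).
  exists q. split; [apply Rdiv_lt_0_compat; lra|]. intros x y.
  assert (Haq : 0 < a - q).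
  { apply Rmult_lt_reg_r with (4 * (a + c)); [lra|].
    replace ((a - q) * (4 * (a + c))) with (4 * a ^ 2 + b ^ 2)
      by (rewrite Rmult_minus_distr_r, Hq; ring).
    nra. }
  assert (Hsquare : 4 * (a - q) * (a * x ^ 2 + b * x * y + c * y ^ 2 - q * (x ^ 2 + y ^ 2))
    = (2 * (a - q) * x + b * y) ^ 2 + (4 * (a - q) * (c - q) - b ^ 2) * y ^ 2) by ring.
  assert (Hdet : 4 * (a - q) * (c - q) - b ^ 2 = 4 * q ^ 2) by lra.
  rewrite Hdet in Hsquare.
  pose proof (pow2_ge_0 (2 * (a - q) * x + b * y)). pose proof (pow2_ge_0 (q * y)).
  apply Rminus_le_0, Rmult_le_reg_l with (4 * (a - q)); lra.
Qed.

(* [- J V'] without saturation, where [gam] is the slope of [g]. *)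
Definition dissipation_form (h k gam e y : R) : R :=
  (h - gam) * e ^ 2 + (k - gam) * e * y + k * y ^ 2.

Lemma dissipation_form_coercive (gl gu h k : R) :
  0 < k -> (k + gl) ^ 2 < 4 * k * h -> (k + gu) ^ 2 < 4 * k * h ->
  exists q, 0 < q /\ forall gam e y, gl <= gam <= gu ->
    q * (e ^ 2 + y ^ 2) <= dissipation_form h k gam e y.
Proof.
  intros Hk Hl Hu.
  destruct (quadratic_form_coercive (h - gl) (k - gl) k Hk) as [ql [Hql Hcl]]; [nra|].
  destruct (quadratic_form_coercive (h - gu) (k - gu) k Hk) as [qu [Hqu Hcu]]; [nra|].
  exists (Rmin ql qu). split; [now apply Rmin_pos|]. intros gam e y Hgam.
  specialize (Hcl e y). specialize (Hcu e y).
  pose proof (Rmin_l ql qu). pose proof (Rmin_r ql qu).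
  assert (Hsq : 0 <= e ^ 2 + y ^ 2) by (pose proof (pow2_ge_0 e); pose proof (pow2_ge_0 y); lra).
  unfold dissipation_form.
  (* The form is affine in [gam]. *)
  destruct (Rle_lt_dec 0 (e ^ 2 + e * y)) as [Hs|Hs].
  - apply Rle_trans with (qu * (e ^ 2 + y ^ 2)); [now apply Rmult_le_compat_r|nra].
  - apply Rle_trans with (ql * (e ^ 2 + y ^ 2)); [now apply Rmult_le_compat_r|nra].
Qed.

(* The threshold on [h] is the minimum over [k] of the larger of [(k + gl)^2 / (4 k)] and
   [(k + gu)^2 / (4 k)], attained at [gu] in the first case and at [- (gl + gu) / 2] in the
   second. *)
Lemma gain_condition_weight (gl gu h : R) :
  gl < 0 -> 0 < gu ->
  (if Rle_dec (- (1/3) * gl) gu then h > gu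
   else h > - (gu - gl) ^ 2 / (8 * (gl + gu))) ->
  exists k, 0 < k /\ (k + gl) ^ 2 < 4 * k * h /\ (k + gu) ^ 2 < 4 * k * h.
Proof.
  intros Hl Hu Hh. destruct Rle_dec as [Hle|Hlt].
  - exists gu. split; [exact Hu|]. split; nra.
  - exists (- (gl + gu) / 2).
    assert (Hsum : 0 < - (gl + gu)) by lra.
    assert (Hq : (gu - gl) ^ 2 < 8 * - (gl + gu) * h).
    { replace ((gu - gl) ^ 2)
        with (8 * - (gl + gu) * (- (gu - gl) ^ 2 / (8 * (gl + gu)))) by (field; lra).
      apply Rmult_lt_compat_l; lra. }
    split; [lra|]. split; nra.
Qed.

Lemma gain_condition_coercive (gl gu h : R) :
  gl < 0 -> 0 < gu ->
  (if Rle_dec (- (1/3) * gl) gu then h > gu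
   else h > - (gu - gl) ^ 2 / (8 * (gl + gu))) ->
  exists k q, 0 < k /\ 0 < q <= h /\ forall gam e y, gl <= gam <= gu ->
    q * (e ^ 2 + y ^ 2) <= dissipation_form h k gam e y.
Proof.
  intros Hl Hu Hh.
  destruct (gain_condition_weight gl gu h Hl Hu Hh) as [k [Hk [Hkl Hku]]].
  destruct (dissipation_form_coercive gl gu h k Hk Hkl Hku) as [q [Hq Hcoercive]].
  exists k, q. split; [exact Hk|]. split; [|exact Hcoercive].
  pose proof (Hcoercive gu 1 0 ltac:(lra)) as Herror. unfold dissipation_form in Herror. lra.
Qed.

(* [J V'], where [gam] is the slope of [g] and [G] its value. *)
Definition lyap_rate (h k gam G e y : R) : R :=
  let u := G - Rmax (G + e + y) 0 in - h * e ^ 2 - gam * e * u + k * y * u.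

(* The coefficient of [y^2] is a lower bound of [- u / (e + y)], which is [1] without saturation
   and [- G / (e + y)] under saturation; this one is continuous in the state. *)
Definition decay_rate (q G e y : R) : R :=
  q * (e ^ 2 + (G + Rmax (G + e + y) 0) / (1 + G + Rabs (G + e + y)) * y ^ 2).

(* [lyap_rate] is affine in [u]. Under saturation [u = G] lies between [0], where it equals
   [- h e^2], and [- (e + y)], where it is minus the unsaturated form. *)
Lemma lyap_rate_saturated (h k gam q G e y : R) :
  0 < q <= h -> 0 <= G -> G + e + y < 0 ->
  q * (e ^ 2 + y ^ 2) <= dissipation_form h k gam e y ->
  lyap_rate h k gam G e y * (1 - (e + y)) <= - q * (e ^ 2 * (1 - (e + y)) + G * y ^ 2).
Proof.
  intros Hq HG Hs Hcoercive. pose proof (pow2_ge_0 e) as He. pose proof (pow2_ge_0 y) as Hy.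
  set (D := lyap_rate h k gam G e y).
  assert (Haffine : D * - (e + y)
    = - (h * e ^ 2 * - (G + e + y)) - G * dissipation_form h k gam e y).
  { unfold D, lyap_rate, dissipation_form. rewrite Rmax_right by lra. ring. }
  assert (Hform : G * (q * (e ^ 2 + y ^ 2)) <= G * dissipation_form h k gam e y)
    by now apply Rmult_le_compat_l.
  assert (Herror : q * e ^ 2 * - (G + e + y) <= h * e ^ 2 * - (G + e + y))
    by (apply Rmult_le_compat_r; [lra|]; now apply Rmult_le_compat_r).
  assert (HGy : 0 <= q * (G * y ^ 2)) by (apply Rmult_le_pos; [lra|now apply Rmult_le_pos]).
  assert (HD : D <= - q * e ^ 2) by (apply Rmult_le_reg_r with (- (e + y)); lra).
  lra.
Qed.

Lemma lyap_rate_le (h k gam q G e y : R) :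
  0 < q <= h -> 0 <= G -> q * (e ^ 2 + y ^ 2) <= dissipation_form h k gam e y ->
  lyap_rate h k gam G e y <= - decay_rate q G e y.
Proof.
  intros Hq HG Hcoercive. pose proof (pow2_ge_0 y) as Hy. unfold decay_rate.
  destruct (Rle_lt_dec 0 (G + e + y)) as [Hs|Hs].
  - assert (Hratio : (G + Rmax (G + e + y) 0) / (1 + G + Rabs (G + e + y)) <= 1).
    { rewrite Rmax_left, Rabs_pos_eq by lra. apply -> Rdiv_le_1; lra. }
    assert (Hrate : lyap_rate h k gam G e y = - dissipation_form h k gam e y).
    { unfold lyap_rate, dissipation_form. rewrite Rmax_left by lra. ring. }
    rewrite Hrate. eapply Rle_trans; [apply Ropp_le_contravar, Hcoercive|].
    apply Ropp_le_contravar, Rmult_le_compat_l; [lra|]. nra.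
  - pose proof (lyap_rate_saturated h k gam q G e y Hq HG Hs Hcoercive) as Hsat.
    rewrite Rmax_right, Rabs_left by lra.
    apply Rmult_le_reg_r with (1 - (e + y)); [lra|].
    eapply Rle_trans; [exact Hsat|]. right. field. lra.
Qed.

Lemma decay_rate_ge_0 (q G e y : R) : 0 < q -> 0 <= G -> 0 <= decay_rate q G e y.
Proof.
  intros Hq HG. unfold decay_rate.
  pose proof (Rabs_pos (G + e + y)). pose proof (Rmax_r (G + e + y) 0).
  apply Rmult_le_pos; [lra|]. apply Rplus_le_le_0_compat; [apply pow2_ge_0|].
  apply Rmult_le_pos; [|apply pow2_ge_0]. apply Rdiv_le_0_compat; lra.
Qed.

Lemma decay_rate_pos (q G e y : R) :
  0 < q -> 0 <= G -> (y < 0 -> 0 < G) -> e <> 0 \/ y <> 0 -> 0 < decay_rate q G e y.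
Proof.
  intros Hq HG Hy Hne. unfold decay_rate. apply Rmult_lt_0_compat; [exact Hq|].
  pose proof (Rabs_pos (G + e + y)). pose proof (Rmax_r (G + e + y) 0).
  destruct (Req_dec e 0) as [->|He].
  - rewrite pow_i, Rplus_0_l by lia. apply Rmult_lt_0_compat; [|apply pow2_gt_0; tauto].
    apply Rdiv_lt_0_compat; [|lra].
    destruct (Rle_lt_dec 0 y) as [Hy0|Hy0]; [|specialize (Hy Hy0); lra].
    pose proof (Rmax_l (G + 0 + y) 0). lra.
  - apply Rplus_lt_le_0_compat; [now apply pow2_gt_0|].
    apply Rmult_le_pos; [|apply pow2_ge_0]. apply Rdiv_le_0_compat; lra.
Qed.

Lemma continuous_decay_rate {U : UniformSpace} (q : R) (G e y : U -> R) (x : U) :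
  0 <= G x -> continuous G x -> continuous e x -> continuous y x ->
  continuous (fun z => decay_rate q (G z) (e z) (y z)) x.
Proof.
  intros HG CG Ce Cy. unfold decay_rate.
  assert (Csqr : forall f : U -> R, continuous f x -> continuous (fun z => f z ^ 2) x).
  { intros f Cf. apply (continuous_comp f (fun r => r ^ 2) x Cf).
    apply @ex_derive_continuous. auto_derive. easy. }
  assert (Cs : continuous (fun z => G z + e z + y z) x).
  { apply @continuous_plus; [|exact Cy]. now apply @continuous_plus. }
  apply @continuous_scal_r, @continuous_plus; [now apply Csqr|].
  apply @continuous_mult; [|now apply Csqr]. apply @continuous_mult.
  - apply @continuous_plus; [exact CG|].
    exact (continuous_comp _ _ x Cs (lipschitz_continuous _ _ lipschitz_pos_part)).
  - pose proof (Rabs_pos (G x + e x + y x)).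
    apply (continuous_comp (fun z => 1 + G z + Rabs (G z + e z + y z)) Rinv);
      [|apply continuous_Rinv; lra].
    apply @continuous_plus; [|exact (continuous_comp _ Rabs x Cs (continuous_Rabs _))].
    apply @continuous_plus; [apply continuous_const|exact CG].
Qed.

(** * Logarithmic speed error and its potential *)

Definition log_error (alpha wrd w : R) : R := alpha * ln (w / wrd).

Lemma log_error_ref (alpha wrd : R) : wrd <> 0 -> log_error alpha wrd wrd = 0.
Proof. intros Hwrd. unfold log_error. rewrite Rdiv_diag, ln_1 by exact Hwrd. ring. Qed.

Lemma log_error_exp (alpha wrd y : R) :
  0 < alpha -> 0 < wrd -> log_error alpha wrd (wrd * exp (y / alpha)) = y.
Proof.
  intros Halpha Hwrd. unfold log_error.
  replace (wrd * exp (y / alpha) / wrd) with (exp (y / alpha)) by (field; lra).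
  rewrite ln_exp. field. lra.
Qed.

Lemma log_error_lt (alpha wrd a b : R) :
  0 < alpha -> 0 < wrd -> 0 < a < b -> log_error alpha wrd a < log_error alpha wrd b.
Proof.
  intros Halpha Hwrd Hab. apply Rmult_lt_compat_l; [exact Halpha|].
  apply ln_increasing; [apply Rdiv_lt_0_compat; lra|].
  apply Rmult_lt_compat_r; [now apply Rinv_0_lt_compat|lra].
Qed.

Lemma log_error_le (alpha wrd a b : R) :
  0 < alpha -> 0 < wrd -> 0 < a <= b -> log_error alpha wrd a <= log_error alpha wrd b.
Proof.
  intros Halpha Hwrd [Ha [Hab| ->]]; [|lra]. left. now apply log_error_lt.
Qed.

Lemma is_derive_log_error (alpha wrd w : R) :
  0 < wrd -> 0 < w -> is_derive (log_error alpha wrd) w (alpha / w).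
Proof.
  intros Hwrd Hw. pose proof (Rdiv_lt_0_compat w wrd Hw Hwrd).
  unfold log_error. auto_derive; [assumption|]. field. lra.
Qed.

Lemma ln_div_le (w v : R) : 0 < w -> 0 < v -> ln (w / v) <= (w - v) / v.
Proof.
  intros Hw Hv. replace ((w - v) / v) with (w / v - 1) by (field; lra).
  pose proof (exp_ineq1_le (ln (w / v))) as Hexp.
  rewrite exp_ln in Hexp by now apply Rdiv_lt_0_compat. lra.
Qed.

Lemma ln_div_ge (w v : R) : 0 < w -> 0 < v -> (w - v) / w <= ln (w / v).
Proof.
  intros Hw Hv. pose proof (ln_div_le v w Hv Hw) as Hle.
  rewrite ln_div in Hle by lra. rewrite ln_div by lra.
  replace ((w - v) / w) with (- ((v - w) / w)) by (field; lra). lra.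
Qed.

Lemma ln_div_mul_ge (v w b : R) :
  0 < v <= b -> 0 < w <= b -> (w - v) ^ 2 / b <= ln (w / v) * (w - v).
Proof.
  intros Hv Hw. replace ((w - v) ^ 2 / b) with ((w - v) / b * (w - v)) by (field; lra).
  pose proof (ln_div_ge w v (proj1 Hw) (proj1 Hv)).
  pose proof (ln_div_le w v (proj1 Hw) (proj1 Hv)).
  assert (Hinv : forall x, 0 < x <= b -> / b <= / x) by (intros x Hx; apply Rinv_le_contravar; lra).
  destruct (Rle_lt_dec v w) as [Hvw|Hwv].
  - apply Rmult_le_compat_r; [lra|]. apply Rle_trans with ((w - v) / w); [|assumption].
    apply Rmult_le_compat_l; [lra|now apply Hinv].
  - rewrite !(Rmult_comm _ (w - v)). apply Rmult_le_compat_neg_l; [lra|].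
    apply Rle_trans with ((w - v) / v); [assumption|].
    apply Rmult_le_compat_neg_l; [lra|now apply Hinv].
Qed.

(* The integral of [ln (s / v)] over [s] from [v] to [w]. *)
Definition log_well (v w : R) : R := w * ln (w / v) - w + v.

Lemma log_well_ref (v : R) : v <> 0 -> log_well v v = 0.
Proof. intros Hv. unfold log_well. rewrite Rdiv_diag, ln_1 by exact Hv. ring. Qed.

Lemma is_derive_log_well (v w : R) :
  0 < v -> 0 < w -> is_derive (log_well v) w (ln (w / v)).
Proof.
  intros Hv Hw. pose proof (Rdiv_lt_0_compat w v Hw Hv).
  unfold log_well. auto_derive; [assumption|]. unfold Rdiv. field. lra.
Qed.

Lemma log_well_ge (v w b : R) :
  0 < v <= b -> 0 < w <= b -> (w - v) ^ 2 / (2 * b) <= log_well v w.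
Proof.
  intros Hv Hw.
  enough (log_well v v - (v - v) ^ 2 / (2 * b) <= log_well v w - (w - v) ^ 2 / (2 * b)) as Hle.
  { rewrite log_well_ref, Rminus_diag in Hle by lra.
    replace (0 ^ 2 / (2 * b)) with 0 in Hle by (field; lra). lra. }
  apply (le_of_derive_sign (fun s => log_well v s - (s - v) ^ 2 / (2 * b))
    (fun s => ln (s / v) - (s - v) / b)).
  intros s Hs.
  assert (Hsb : 0 < s <= b).
  { pose proof (Rmin_glb_lt v w 0). pose proof (Rmax_lub v w b). lra. }
  split.
  - apply (is_derive_minus (log_well v)); [apply is_derive_log_well; lra|].
    auto_derive; [easy|]. field. lra.
  - pose proof (ln_div_mul_ge v s b Hv Hsb) as Hslope.
    replace ((s - v) ^ 2 / b) with ((s - v) / b * (s - v)) in Hslope by (field; lra). lra.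
Qed.

(** * The closed loop *)

Lemma is_solution_forward (F1 F2 : R -> R -> R) (w gh : R -> R) :
  is_solution F1 F2 w gh <->
  (forall t, 0 <= t -> 0 < w t) /\
  is_forward_derive w (fun t => F1 (w t) (gh t)) /\
  is_forward_derive gh (fun t => F2 (w t) (gh t)).
Proof.
  split.
  - intros [Hpos [Hw0 [Hgh0 Hd]]].
    split; [exact Hpos|]. split; (split; [assumption|]); intros t Ht; now apply Hd.
  - intros [Hpos [[Hw0 Hdw] [Hgh0 Hdgh]]].
    split; [exact Hpos|]. split; [exact Hw0|]. split; [exact Hgh0|]. auto.
Qed.

Definition lyap (g : R -> R) (k alpha wrd w gh : R) : R :=
  (gh - g w) ^ 2 / 2 + k * alpha * log_well wrd w.

Section ClosedLoop.

Variables (g dg : R -> R) (J h alpha wrd w1 L : R).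
Hypothesis J_pos : 0 < J.
Hypothesis h_pos : 0 < h.
Hypothesis alpha_pos : 0 < alpha.
Hypothesis wrd_range : 0 < wrd <= w1.
Hypothesis g_w1 : g w1 = 0.
Hypothesis g_pos : forall w, 0 < w < w1 -> 0 < g w.
Hypothesis g_derive : forall w, 0 < w -> is_derive g w (dg w).
Hypothesis g_slope : forall w, 0 < w -> Rabs (dg w) <= L.

Let F1 := rhs_w J alpha wrd g.
Let F2 := rhs_g J h g.

Lemma slope_bound_ge_0 : 0 <= L.
Proof. pose proof (g_slope 1 Rlt_0_1). pose proof (Rabs_pos (dg 1)). lra. Qed.

Lemma g_increment_le (a b : R) : 0 < a -> 0 < b -> Rabs (g b - g a) <= L * Rabs (b - a).
Proof.
  intros Ha Hb. apply (Rabs_increment_le g dg). intros c Hc.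
  pose proof (Rmin_glb_lt a b 0 Ha Hb). split; [apply g_derive|apply g_slope]; lra.
Qed.

Lemma g_le_dist_w1 (w : R) : 0 < w -> g w <= L * Rabs (w - w1).
Proof.
  intros Hw. pose proof (g_increment_le w1 w ltac:(lra) Hw) as Hinc.
  rewrite g_w1, Rminus_0_r in Hinc. apply Rle_trans with (2 := Hinc), Rle_abs.
Qed.

Lemma g_ge_0 (w : R) : 0 < w <= w1 -> 0 <= g w.
Proof.
  intros [Hw [Hlt| ->]]; [|rewrite g_w1; lra]. left. apply g_pos. lra.
Qed.

Lemma equilibrium_unique (w gh : R) :
  0 < w <= w1 -> (F1 w gh = 0 /\ F2 w gh = 0 <-> w = wrd /\ gh = g wrd).
Proof.
  intros Hw. pose proof (Rinv_0_lt_compat J J_pos) as HJ.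
  unfold F1, F2, rhs_w, rhs_g. change (alpha * ln (w / wrd)) with (log_error alpha wrd w). split.
  - intros [Hspeed Hestimate].
    assert (Hgh : gh = g w).
    { apply Rmult_integral in Hestimate. pose proof (Rdiv_lt_0_compat h J h_pos J_pos). lra. }
    assert (Htorque : g w = Rmax (gh + log_error alpha wrd w) 0).
    { apply Rmult_integral in Hspeed. lra. }
    enough (w = wrd) as -> by tauto.
    subst gh. pose proof (log_error_ref alpha wrd ltac:(lra)) as Href.
    destruct (Rtotal_order w wrd) as [Hlt|[Heq|Hgt]]; [exfalso|exact Heq|exfalso].
    + pose proof (g_pos w ltac:(lra)).
      pose proof (log_error_lt alpha wrd w wrd alpha_pos (proj1 wrd_range) ltac:(lra)).
      unfold Rmax in Htorque. destruct Rle_dec in Htorque; lra.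
    + pose proof (log_error_lt alpha wrd wrd w alpha_pos (proj1 wrd_range) ltac:(lra)).
      pose proof (Rmax_l (g w + log_error alpha wrd w) 0). lra.
  - intros [-> ->]. pose proof (g_ge_0 wrd Hw).
    rewrite log_error_ref, Rplus_0_r, Rmax_left by lra. split; unfold Rdiv; ring.
Qed.

Definition estimate_ceiling (gh0 : R) : R := Rmax gh0 (L * w1).

Definition speed_floor (w0 gh0 : R) : R :=
  Rmin w0 (wrd * exp (- estimate_ceiling gh0 / alpha)).

Lemma speed_floor_range (w0 gh0 : R) : 0 < w0 -> 0 < speed_floor w0 gh0 <= w0.
Proof.
  intros Hw0. split; [|apply Rmin_l]. apply Rmin_pos; [exact Hw0|].
  apply Rmult_lt_0_compat; [lra|apply exp_pos].
Qed.

Section Driven.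

(* The speed [v] at which the field is evaluated is [w] for the closed loop itself, and a
   truncation of [w] in the proof that solutions exist. *)
Variables v w gh : R -> R.
Hypothesis w_derive : is_forward_derive w (fun t => F1 (v t) (gh t)).
Hypothesis gh_derive : is_forward_derive gh (fun t => F2 (v t) (gh t)).

Lemma driven_speed_le :
  w 0 <= w1 -> (forall t, 0 < t -> w1 < w t -> w1 <= v t <= w t) ->
  forall t, 0 <= t -> w t <= w1.
Proof.
  intros H0 Hv. apply (barrier_above w _ (L / J) w1 w_derive H0). intros t Ht Hlt.
  specialize (Hv t Ht Hlt). unfold F1, rhs_w.
  set (torque := Rmax (gh t + alpha * ln (v t / wrd)) 0).
  assert (0 <= torque) by apply Rmax_r.
  pose proof (g_le_dist_w1 (v t) ltac:(lra)) as Hg. rewrite Rabs_pos_eq in Hg by lra.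
  pose proof slope_bound_ge_0.
  assert (L * (v t - w1) <= L * (w t - w1)) by (apply Rmult_le_compat_l; lra).
  replace (L / J * (w t - w1)) with (L * (w t - w1) / J) by (field; lra).
  apply Rmult_le_compat_r; [left; now apply Rinv_0_lt_compat|lra].
Qed.

Hypothesis v_range : forall t, 0 < t -> 0 < v t <= w1.

Lemma driven_estimate_le : forall t, 0 <= t -> gh t <= estimate_ceiling (gh 0).
Proof.
  apply (barrier_above gh _ 0 _ gh_derive); [apply Rmax_l|]. intros t Ht Hlt.
  pose proof (v_range t Ht) as Hvt. unfold F2, rhs_g.
  pose proof (g_le_dist_w1 (v t) (proj1 Hvt)) as Hg. rewrite Rabs_left1 in Hg by lra.
  pose proof slope_bound_ge_0.
  assert (L * - (v t - w1) <= L * w1) by (apply Rmult_le_compat_l; lra).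
  assert (L * w1 <= estimate_ceiling (gh 0)) by apply Rmax_r.
  pose proof (Rdiv_lt_0_compat h J h_pos J_pos). nra.
Qed.

(* Below the floor the control torque vanishes. *)
Lemma driven_speed_ge :
  0 < w 0 ->
  (forall t, 0 < t -> w t < speed_floor (w 0) (gh 0) -> v t <= speed_floor (w 0) (gh 0)) ->
  forall t, 0 <= t -> speed_floor (w 0) (gh 0) <= w t.
Proof.
  intros H0 Hv. set (m := speed_floor (w 0) (gh 0)) in *.
  apply (barrier_below w _ 0 m w_derive); [apply Rmin_l|]. intros t Ht Hlt.
  pose proof (v_range t Ht) as Hvt. specialize (Hv t Ht Hlt).
  unfold F1, rhs_w. change (alpha * ln (v t / wrd)) with (log_error alpha wrd (v t)).
  assert (Hlog : log_error alpha wrd (v t) <= - estimate_ceiling (gh 0)).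
  { rewrite <- (log_error_exp alpha wrd (- estimate_ceiling (gh 0))) by lra.
    apply log_error_le; [lra|lra|]. split; [lra|].
    apply Rle_trans with m; [exact Hv|apply Rmin_r]. }
  pose proof (driven_estimate_le t ltac:(lra)). pose proof (g_ge_0 (v t) Hvt).
  rewrite Rmax_right by lra. rewrite Rmult_0_l. apply Rdiv_le_0_compat; lra.
Qed.

End Driven.

Lemma solution_invariant (w gh : R -> R) :
  is_solution F1 F2 w gh -> w 0 <= w1 -> forall t, 0 <= t -> 0 < w t <= w1.
Proof.
  intros Hsol H0 t Ht. apply is_solution_forward in Hsol. destruct Hsol as [Hpos [Hw _]].
  split; [now apply Hpos|].
  apply (driven_speed_le w w gh Hw H0); [|exact Ht]. intros s _ Hlt. lra.
Qed.

Lemma solution_speed_ge (w gh : R -> R) :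
  is_solution F1 F2 w gh -> w 0 <= w1 ->
  forall t, 0 <= t -> speed_floor (w 0) (gh 0) <= w t.
Proof.
  intros Hsol H0. pose proof (solution_invariant w gh Hsol H0) as HD.
  apply is_solution_forward in Hsol. destruct Hsol as [_ [Hw Hgh]].
  apply (driven_speed_ge w w gh Hw Hgh); [|apply HD; lra|intros; lra].
  intros t Ht. apply HD. lra.
Qed.

Definition truncated_field (m : R) (p : R * R) : R * R :=
  (F1 (clamp m w1 (fst p)) (snd p), F2 (clamp m w1 (fst p)) (snd p)).

Lemma lipschitz_truncated_field (m : R) : 0 < m <= w1 -> lipschitz (truncated_field m).
Proof.
  intros Hm.
  assert (Hspeed : lipschitz (fun p : R * R => fst p)) by apply lipschitz_linear, is_linear_fst.
  assert (Hgh : lipschitz (fun p : R * R => snd p)) by apply lipschitz_linear, is_linear_snd.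
  assert (Hg : lipschitz (fun p : R * R => g (clamp m w1 (fst p)))).
  { apply (lipschitz_comp fst (fun x => g (clamp m w1 x)) Hspeed).
    apply (lipschitz_clamp g dg _ _ L); [lra|]. intros c Hc.
    split; [apply g_derive|apply g_slope]; lra. }
  assert (Hlog : lipschitz (fun p : R * R => log_error alpha wrd (clamp m w1 (fst p)))).
  { apply (lipschitz_comp fst (fun x => log_error alpha wrd (clamp m w1 x)) Hspeed).
    apply (lipschitz_clamp _ (fun x => alpha / x) _ _ (alpha / m)); [lra|]. intros c Hc.
    split; [apply is_derive_log_error; lra|].
    rewrite Rabs_pos_eq by (apply Rdiv_le_0_compat; lra).
    apply Rmult_le_compat_l; [lra|]. apply Rinv_le_contravar; lra. }
  set (control := fun p : R * R => Rmax (snd p + log_error alpha wrd (clamp m w1 (fst p))) 0).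
  assert (Hcontrol : lipschitz control).
  { exact (lipschitz_comp _ _ (lipschitz_plus _ _ Hgh Hlog) lipschitz_pos_part). }
  apply lipschitz_pair.
  - apply (lipschitz_comp (fun p => g (clamp m w1 (fst p)) - control p) (fun x => x / J)).
    + exact (lipschitz_plus _ _ Hg (lipschitz_opp _ Hcontrol)).
    + apply lipschitz_linear. exact (is_linear_scal_l (/ J)).
  - apply (lipschitz_comp (fun p => g (clamp m w1 (fst p)) - snd p) (fun x => h / J * x)).
    + exact (lipschitz_plus _ _ Hg (lipschitz_opp _ Hgh)).
    + apply lipschitz_linear. exact (is_linear_scal_r (h / J) Rmult_comm).
Qed.

Lemma solution_exists (w0 gh0 : R) :
  0 < w0 <= w1 -> exists w gh, is_solution F1 F2 w gh /\ w 0 = w0 /\ gh 0 = gh0.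
Proof.
  intros Hw0. set (m := speed_floor w0 gh0).
  assert (Hm : 0 < m <= w0) by (apply speed_floor_range; lra).
  destruct (picard_lindelof (truncated_field m) (w0, gh0)) as [p [Hp0 Hp]].
  { apply lipschitz_truncated_field. lra. }
  set (w := fun t => fst (p t)). set (gh := fun t => snd (p t)).
  set (v := fun t => clamp m w1 (w t)).
  assert (Hw : is_forward_derive w (fun t => F1 (v t) (gh t))).
  { apply is_derive_forward. intros t. exact (is_derive_fst _ _ _ (Hp t)). }
  assert (Hgh : is_forward_derive gh (fun t => F2 (v t) (gh t))).
  { apply is_derive_forward. intros t. exact (is_derive_snd _ _ _ (Hp t)). }
  assert (Ew0 : w 0 = w0) by (unfold w; now rewrite Hp0).
  assert (Egh0 : gh 0 = gh0) by (unfold gh; now rewrite Hp0).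
  assert (Hle : forall t, 0 <= t -> w t <= w1).
  { apply (driven_speed_le v w gh Hw); [lra|]. intros t _ Hlt. unfold v. rewrite clamp_above; lra. }
  assert (Hge : forall t, 0 <= t -> m <= w t).
  { unfold m. rewrite <- Ew0, <- Egh0. apply (driven_speed_ge v w gh Hw Hgh).
    - intros t _. pose proof (clamp_bounds m w1 (w t) ltac:(lra)). unfold v. lra.
    - lra.
    - rewrite Ew0, Egh0. fold m. intros t _ Hlt. unfold v. rewrite clamp_below; lra. }
  assert (Hv : forall t, 0 < t -> v t = w t).
  { intros t Ht. apply clamp_id. split; [apply Hge|apply Hle]; lra. }
  exists w, gh. split; [|now split]. apply is_solution_forward. split; [|split].
  - intros t Ht. specialize (Hge t Ht). lra.
  - refine (is_forward_derive_ext _ _ _ _ Hw). intros t Ht. now rewrite Hv.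
  - refine (is_forward_derive_ext _ _ _ _ Hgh). intros t Ht. now rewrite Hv.
Qed.

Variables k q : R.
Hypothesis k_pos : 0 < k.
Hypothesis q_range : 0 < q <= h.
Hypothesis form_coercive : forall w e y, 0 < w ->
  q * (e ^ 2 + y ^ 2) <= dissipation_form h k (dg w) e y.

Let V := lyap g k alpha wrd.
Let decay (w gh : R) := decay_rate q (g w) (gh - g w) (log_error alpha wrd w).

Lemma is_forward_derive_lyap (w gh : R -> R) :
  is_solution F1 F2 w gh ->
  is_forward_derive (fun t => V (w t) (gh t)) (fun t =>
    lyap_rate h k (dg (w t)) (g (w t)) (gh t - g (w t)) (log_error alpha wrd (w t)) / J).
Proof.
  intros Hsol. apply is_solution_forward in Hsol. destruct Hsol as [Hpos [Hw Hgh]].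
  assert (Herror : is_forward_derive (fun t => gh t - g (w t))
    (fun t => F2 (w t) (gh t) + - dg (w t) * F1 (w t) (gh t))).
  { apply (is_forward_derive_plus _ _ _ _ Hgh).
    apply (is_forward_derive_comp (fun x => - g x) (fun x => - dg x) _ _); [|exact Hw].
    intros t Ht. apply @is_derive_opp, g_derive, Hpos, Ht. }
  assert (Hwell : is_forward_derive (fun t => k * alpha * log_well wrd (w t))
    (fun t => k * alpha * ln (w t / wrd) * F1 (w t) (gh t))).
  { apply (is_forward_derive_comp (fun x => k * alpha * log_well wrd x)
      (fun x => k * alpha * ln (x / wrd)) _ _); [|exact Hw].
    intros t Ht. apply @is_derive_scal, is_derive_log_well; [lra|now apply Hpos]. }
  assert (Hsqr : is_forward_derive (fun t => (gh t - g (w t)) ^ 2 / 2)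
    (fun t => (gh t - g (w t)) * (F2 (w t) (gh t) + - dg (w t) * F1 (w t) (gh t)))).
  { apply (is_forward_derive_comp (fun e => e ^ 2 / 2) (fun e => e) _ _); [|exact Herror].
    intros t _. auto_derive; [easy|]. field. }
  refine (is_forward_derive_ext _ _ _ _ (is_forward_derive_plus _ _ _ _ Hsqr Hwell)).
  intros t _. unfold lyap_rate, F1, F2, rhs_w, rhs_g, log_error.
  replace (g (w t) + (gh t - g (w t)) + alpha * ln (w t / wrd))
    with (gh t + alpha * ln (w t / wrd)) by ring.
  field. lra.
Qed.

Lemma lyap_rate_le_decay (w gh : R) :
  0 < w <= w1 ->
  lyap_rate h k (dg w) (g w) (gh - g w) (log_error alpha wrd w) / J <= - decay w gh / J.
Proof.
  intros Hw. apply Rmult_le_compat_r; [left; now apply Rinv_0_lt_compat|].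
  apply lyap_rate_le; [exact q_range|now apply g_ge_0|now apply form_coercive].
Qed.

Lemma decay_ge_0 (w gh : R) : 0 < w <= w1 -> 0 <= decay w gh.
Proof. intros Hw. apply decay_rate_ge_0; [apply q_range|now apply g_ge_0]. Qed.

Lemma decay_pos (w gh : R) :
  0 < w <= w1 -> w <> wrd \/ gh <> g wrd -> 0 < decay w gh.
Proof.
  intros Hw Hne. pose proof (log_error_ref alpha wrd ltac:(lra)) as Href.
  assert (Hlt : forall a b, 0 < a < b -> log_error alpha wrd a < log_error alpha wrd b)
    by (intros; apply log_error_lt; lra).
  apply decay_rate_pos; [apply q_range|now apply g_ge_0| |].
  - intros Hneg. apply g_pos. split; [lra|]. apply Rnot_le_lt. intros Hge.
    pose proof (log_error_le alpha wrd wrd w alpha_pos ltac:(lra) ltac:(lra)). lra.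
  - destruct (Rtotal_order w wrd) as [Hw'|[->|Hw']].
    + right. pose proof (Hlt w wrd ltac:(lra)). lra.
    + left. destruct Hne; [easy|lra].
    + right. pose proof (Hlt wrd w ltac:(lra)). lra.
Qed.

Lemma lyap_nonincreasing (w gh : R -> R) :
  is_solution F1 F2 w gh -> w 0 <= w1 ->
  forall t, 0 <= t -> V (w t) (gh t) <= V (w 0) (gh 0).
Proof.
  intros Hsol H0 t Ht.
  apply (forward_nonincreasing _ _ 0 t (is_forward_derive_lyap w gh Hsol)); [lra|].
  intros s Hs. pose proof (solution_invariant w gh Hsol H0 s ltac:(lra)) as Hws.
  eapply Rle_trans; [now apply lyap_rate_le_decay|].
  pose proof (Rdiv_le_0_compat _ J (decay_ge_0 (w s) (gh s) Hws) J_pos). lra.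
Qed.

Lemma lyap_quadratic_lower_bound :
  exists B, 0 < B /\ forall w gh, 0 < w <= w1 ->
    (w - wrd) ^ 2 <= B * V w gh /\ (gh - g wrd) ^ 2 <= B * V w gh.
Proof.
  assert (Hka : 0 < k * alpha) by now apply Rmult_lt_0_compat.
  set (C := 2 * w1 / (k * alpha)).
  assert (HC : 0 < C) by (apply Rdiv_lt_0_compat; lra).
  assert (HLC : 0 <= L ^ 2 * C) by (apply Rmult_le_pos; [apply pow2_ge_0|lra]).
  exists (C + 4 + 2 * (L ^ 2 * C)). split; [lra|]. intros w gh Hw.
  pose proof (pow2_ge_0 (w - wrd)). pose proof (pow2_ge_0 (gh - g w)).
  assert (Hwell : (w - wrd) ^ 2 / C <= k * alpha * log_well wrd w).
  { replace ((w - wrd) ^ 2 / C) with (k * alpha * ((w - wrd) ^ 2 / (2 * w1)))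
      by (unfold C; field; lra).
    apply Rmult_le_compat_l; [lra|]. now apply log_well_ge. }
  assert (Hwell0 : 0 <= (w - wrd) ^ 2 / C) by (apply Rdiv_le_0_compat; lra).
  assert (Herror : (gh - g w) ^ 2 <= 2 * V w gh) by (unfold V, lyap; lra).
  assert (Hspeed : (w - wrd) ^ 2 <= C * V w gh).
  { replace ((w - wrd) ^ 2) with (C * ((w - wrd) ^ 2 / C)) by (field; lra).
    apply Rmult_le_compat_l; [lra|]. unfold V, lyap. lra. }
  assert (Hslope : (g w - g wrd) ^ 2 <= L ^ 2 * (w - wrd) ^ 2).
  { rewrite <- Rpow_mult_distr, <- (pow2_abs (g w - g wrd)), <- (pow2_abs (L * (w - wrd))).
    apply pow_incr. split; [apply Rabs_pos|].
    rewrite Rabs_mult, (Rabs_pos_eq L) by apply slope_bound_ge_0.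
    apply g_increment_le; lra. }
  assert (HLspeed : L ^ 2 * (w - wrd) ^ 2 <= L ^ 2 * C * V w gh).
  { rewrite Rmult_assoc. apply Rmult_le_compat_l; [apply pow2_ge_0|exact Hspeed]. }
  assert (HV : 0 <= V w gh) by lra.
  assert (0 <= C * V w gh) by (apply Rmult_le_pos; lra).
  assert (0 <= L ^ 2 * C * V w gh) by now apply Rmult_le_pos.
  pose proof (pow2_ge_0 ((gh - g w) - (g w - g wrd))).
  split; lra.
Qed.

Lemma continuous_g_fst (w gh : R) : 0 < w -> continuous (fun z : R * R => g (fst z)) (w, gh).
Proof.
  intros Hw. apply (continuous_comp fst g (w, gh) (continuous_fst w gh)).
  apply @ex_derive_continuous. eexists. now apply g_derive.
Qed.

Lemma continuous_estimation_error (w gh : R) :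
  0 < w -> continuous (fun z : R * R => snd z - g (fst z)) (w, gh).
Proof.
  intros Hw. apply (continuous_minus snd (fun z => g (fst z)) (w, gh) (continuous_snd w gh)).
  now apply continuous_g_fst.
Qed.

Lemma continuous_lyap (w gh : R) : 0 < w -> continuous (fun z => V (fst z) (snd z)) (w, gh).
Proof.
  intros Hw. apply @continuous_plus.
  - apply (continuous_comp (fun z => snd z - g (fst z)) (fun e => e ^ 2 / 2)).
    + now apply continuous_estimation_error.
    + apply @ex_derive_continuous. auto_derive. easy.
  - apply @continuous_scal_r, (continuous_comp fst (log_well wrd) (w, gh) (continuous_fst w gh)).
    apply @ex_derive_continuous. eexists. apply is_derive_log_well; [apply wrd_range|exact Hw].
Qed.

Lemma continuous_decay (w gh : R) :
  0 < w <= w1 -> continuous (fun z => decay (fst z) (snd z)) (w, gh).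
Proof.
  intros Hw. apply (continuous_decay_rate q (fun z : R * R => g (fst z))
    (fun z => snd z - g (fst z)) (fun z => log_error alpha wrd (fst z))).
  - now apply g_ge_0.
  - now apply continuous_g_fst.
  - now apply continuous_estimation_error.
  - apply (continuous_comp fst (log_error alpha wrd) (w, gh) (continuous_fst w gh)).
    apply @ex_derive_continuous. eexists. apply is_derive_log_error; [apply wrd_range|apply Hw].
Qed.

Lemma lyap_equilibrium : V wrd (g wrd) = 0.
Proof. unfold V, lyap. rewrite log_well_ref by lra. field. Qed.

Lemma solution_stable (eps : R) :
  0 < eps -> exists delta, 0 < delta /\
    forall w gh, is_solution F1 F2 w gh -> 0 < w 0 <= w1 ->
      Rabs (w 0 - wrd) < delta -> Rabs (gh 0 - g wrd) < delta ->
      forall t, 0 <= t -> Rabs (w t - wrd) < eps /\ Rabs (gh t - g wrd) < eps.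
Proof.
  intros Heps. destruct lyap_quadratic_lower_bound as [B [HB Hbound]].
  assert (Hsublevel : 0 < eps ^ 2 / B) by (apply Rdiv_lt_0_compat; [now apply pow_lt|exact HB]).
  destruct (proj1 (filterlim_locally _ _) (continuous_lyap wrd (g wrd) (proj1 wrd_range))
    (mkposreal _ Hsublevel)) as [delta Hdelta].
  exists delta. split; [apply cond_pos|]. intros w gh Hsol H0 Hw0 Hgh0 t Ht.
  specialize (Hdelta (w 0, gh 0) (conj Hw0 Hgh0)). apply Rabs_lt_between' in Hdelta.
  simpl in Hdelta. rewrite lyap_equilibrium in Hdelta.
  pose proof (lyap_nonincreasing w gh Hsol (proj2 H0) t Ht) as Hdecr.
  assert (HBV : B * V (w t) (gh t) < eps ^ 2).
  { replace (eps ^ 2) with (B * (eps ^ 2 / B)) by (field; lra). apply Rmult_lt_compat_l; lra. }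
  pose proof (solution_invariant w gh Hsol (proj2 H0) t Ht) as Hwt.
  destruct (Hbound (w t) (gh t) Hwt) as [Hspeed Hestimate].
  split; apply Rabs_lt_of_sqr_lt; lra.
Qed.

Lemma decay_uniform (m r eta : R) :
  0 < m -> 0 < eta -> exists c, 0 < c /\ forall w gh,
    m <= w <= w1 -> g wrd - r <= gh <= g wrd + r -> eta <= V w gh -> c <= decay w gh.
Proof.
  intros Hm Heta.
  destruct (continuous_pos_lower_bound
    (fun p => decay (fst p) (snd p) + Rmax (eta - V (fst p) (snd p)) 0)
    m w1 (g wrd - r) (g wrd + r)) as [c [Hc Hle]].
  - intros w gh Hw _. simpl. split.
    + apply @continuous_plus; [apply continuous_decay; lra|].
      apply (continuous_comp (fun z : R * R => eta - V (fst z) (snd z)) (fun x => Rmax x 0)).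
      * apply @continuous_minus; [apply continuous_const|apply continuous_lyap; lra].
      * exact (lipschitz_continuous _ _ lipschitz_pos_part).
    + pose proof (decay_ge_0 w gh ltac:(lra)). pose proof (Rmax_r (eta - V w gh) 0).
      destruct (Req_dec w wrd) as [->|Hne]; [destruct (Req_dec gh (g wrd)) as [->|Hne]|].
      * pose proof (Rmax_l (eta - V wrd (g wrd)) 0). rewrite lyap_equilibrium in *. lra.
      * pose proof (decay_pos wrd gh ltac:(lra) (or_intror Hne)). lra.
      * pose proof (decay_pos w gh ltac:(lra) (or_introl Hne)). lra.
  - exists c. split; [exact Hc|]. intros w gh Hw Hgh HV.
    specialize (Hle w gh Hw Hgh). simpl in Hle. rewrite Rmax_right in Hle by lra. lra.
Qed.

Lemma solution_lyap_vanishes (w gh : R -> R) :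
  is_solution F1 F2 w gh -> w 0 <= w1 ->
  filterlim (fun t => V (w t) (gh t)) (Rbar_locally p_infty) (locally 0).
Proof.
  intros Hsol H0. destruct lyap_quadratic_lower_bound as [B [HB Hbound]].
  pose proof (solution_invariant w gh Hsol H0) as HD.
  assert (Hw0 : 0 < w 0) by (apply HD; lra).
  apply (lyapunov_vanishes _ _ (is_forward_derive_lyap w gh Hsol)).
  - intros t Ht. destruct (Hbound _ (gh t) (HD t Ht)) as [Hspeed _].
    pose proof (pow2_ge_0 (w t - wrd)). apply Rmult_le_reg_l with B; lra.
  - intros t Ht. eapply Rle_trans; [apply lyap_rate_le_decay, HD; lra|].
    pose proof (Rdiv_le_0_compat _ J (decay_ge_0 (w t) (gh t) (HD t ltac:(lra))) J_pos). lra.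
  - intros eta Heta.
    destruct (decay_uniform (speed_floor (w 0) (gh 0)) (B * V (w 0) (gh 0) + 1) eta)
      as [c [Hc Hdecay]]; [now apply speed_floor_range|exact Heta|].
    exists (c / J). split; [now apply Rdiv_lt_0_compat|]. intros t Ht HVt.
    eapply Rle_trans; [apply lyap_rate_le_decay, HD; lra|].
    enough (c / J <= decay (w t) (gh t) / J) by lra.
    apply Rmult_le_compat_r; [left; now apply Rinv_0_lt_compat|]. apply Hdecay; [| |exact HVt].
    + split; [apply (solution_speed_ge w gh Hsol H0)|apply HD]; lra.
    + destruct (Hbound _ (gh t) (HD t ltac:(lra))) as [_ Hestimate].
      assert (B * V (w t) (gh t) <= B * V (w 0) (gh 0)).
      { apply Rmult_le_compat_l; [lra|]. apply (lyap_nonincreasing w gh Hsol H0). lra. }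
      pose proof (pow2_ge_0 (gh t - g wrd - 1)). pose proof (pow2_ge_0 (gh t - g wrd + 1)).
      split; nra.
Qed.

Lemma solution_attracted (w gh : R -> R) :
  is_solution F1 F2 w gh -> w 0 <= w1 ->
  filterlim w (Rbar_locally p_infty) (locally wrd) /\
  filterlim gh (Rbar_locally p_infty) (locally (g wrd)).
Proof.
  intros Hsol H0. destruct lyap_quadratic_lower_bound as [B [HB Hbound]].
  pose proof (solution_lyap_vanishes w gh Hsol H0) as HV.
  split; apply (filterlim_of_sqr_le _ _ B _ HB HV); exists 0; intros t Ht;
    apply (Hbound (w t) (gh t)), (solution_invariant w gh Hsol H0); lra.
Qed.

End ClosedLoop.

Lemma ex_derive_gfun (rho A Rad Cf a' beta Vw w : R) (Cp : R -> R -> R) :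
  w <> 0 -> ex_derive (fun l => Cp l beta) (w * Rad / Vw) ->
  ex_derive (gfun rho A Rad Cf a' Cp beta Vw) w.
Proof. intros Hw HCp. unfold gfun. auto_derive. now repeat split. Qed.

Theorem theorem1
  (rho A Rad J Cf a' bmin bmax beta Vw : R) (Cp : R -> R -> R)
  (w1 gl gu wrd alpha h : R)
  (Hrho : 0 < rho) (HA : 0 < A) (HRad : 0 < Rad) (HJ : 0 < J) (HCf : 0 < Cf)
  (Ha' : a' < 0) (Hbeta : bmin <= beta <= bmax) (HVw : 0 < Vw)
  (* (A1) Cp is C^1 on (0,oo) x [bmin,bmax]: continuous partial derivatives
     (one-sided in beta at the endpoints of [bmin,bmax]) *)
  (HA1 : exists Dl Db : R -> R -> R,
     (forall l b, 0 < l -> bmin <= b <= bmax ->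
        is_derive (fun l' => Cp l' b) l (Dl l b) /\
        filterlim (fun b' => (Cp l b' - Cp l b) / (b' - b))
          (within (fun b' => bmin <= b' <= bmax /\ b' <> b) (locally b))
          (locally (Db l b)) /\
        filterlim (fun p : R * R => Dl (fst p) (snd p))
          (within (fun p : R * R => 0 < fst p /\ bmin <= snd p <= bmax)
             (locally (l, b)))
          (locally (Dl l b)) /\
        filterlim (fun p : R * R => Db (fst p) (snd p))
          (within (fun p : R * R => 0 < fst p /\ bmin <= snd p <= bmax)
             (locally (l, b)))
          (locally (Db l b))))
  (* (A2) *)
  (HA2 : exists c, 0 < c /\
     forall l b, 0 < l -> bmin <= b <= bmax -> Cp l b <= c * l)
  (* (A3) *)
  (HA3 : forall b, bmin <= b <= bmax ->
     exists l1, 0 < l1 /\ forall l, 0 < l < l1 -> 0 < Cp l b)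
  (* (A4) *)
  (HA4 : exists cl cu, cl < 0 /\ 0 < cu /\
     forall l b, 0 < l -> bmin <= b <= bmax ->
       cl <= Derive (fun l' => Cp l' b / l') l <= cu)
  (* omega_r^(1) *)
  (Hw1 : 0 < w1)
  (Hgw1 : gfun rho A Rad Cf a' Cp beta Vw w1 = 0)
  (Hgpos : forall w, 0 < w < w1 -> 0 < gfun rho A Rad Cf a' Cp beta Vw w)
  (* bounds on dg/dw *)
  (Hgl : gl < 0) (Hgu : 0 < gu)
  (Hgam : forall w, 0 < w ->
     gl <= Derive (gfun rho A Rad Cf a' Cp beta Vw) w <= gu)
  (* desired speed and gains *)
  (Hwrd : 0 < wrd <= w1)
  (Halpha : 0 < alpha)
  (Hh : if Rle_dec (- (1/3) * gl) gu then h > gu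
        else h > - (gu - gl) ^ 2 / (8 * (gl + gu))) :
  let g := gfun rho A Rad Cf a' Cp beta Vw in
  let F1 := rhs_w J alpha wrd g in
  let F2 := rhs_g J h g in
  (* (i) unique equilibrium in D *)
  (forall w gh, inD w1 w gh ->
     (F1 w gh = 0 /\ F2 w gh = 0 <-> (w = wrd /\ gh = g wrd))) /\
  (* (ii) D is positively invariant (and solutions from D exist globally) *)
  (forall w0 gh0, inD w1 w0 gh0 ->
     exists w gh, is_solution F1 F2 w gh /\ w 0 = w0 /\ gh 0 = gh0) /\
  (forall w gh, is_solution F1 F2 w gh -> inD w1 (w 0) (gh 0) ->
     forall t, 0 <= t -> inD w1 (w t) (gh t)) /\
  (* (iii) local (Lyapunov) stability, relative to D ... *)
  (forall eps, 0 < eps -> exists delta, 0 < delta /\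
     forall w gh, is_solution F1 F2 w gh -> inD w1 (w 0) (gh 0) ->
       Rabs (w 0 - wrd) < delta -> Rabs (gh 0 - g wrd) < delta ->
       forall t, 0 <= t -> Rabs (w t - wrd) < eps /\ Rabs (gh t - g wrd) < eps) /\
  (* ... with domain of attraction D *)
  (forall w gh, is_solution F1 F2 w gh -> inD w1 (w 0) (gh 0) ->
     filterlim w (Rbar_locally p_infty) (locally wrd) /\
     filterlim gh (Rbar_locally p_infty) (locally (g wrd))).
Proof.
  intros g F1 F2.
  destruct (gain_condition_coercive gl gu h Hgl Hgu Hh) as [k [q [Hk [Hq Hform]]]].
  assert (Hh_pos : 0 < h) by lra.
  assert (Hderive : forall w, 0 < w -> is_derive g w (Derive g w)).
  { intros w Hw. apply Derive_correct, ex_derive_gfun; [lra|].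
    assert (Hl : 0 < w * Rad / Vw) by (apply Rdiv_lt_0_compat; [now apply Rmult_lt_0_compat|lra]).
    destruct HA1 as [Dl [Db HD]]. eexists. apply (HD _ beta Hl Hbeta). }
  assert (Hslope : forall w, 0 < w -> Rabs (Derive g w) <= gu - gl).
  { intros w Hw. apply Rabs_le. pose proof (Hgam w Hw). unfold g. lra. }
  assert (Hcoercive : forall w e y, 0 < w ->
    q * (e ^ 2 + y ^ 2) <= dissipation_form h k (Derive g w) e y).
  { intros w e y Hw. now apply Hform, Hgam. }
  split; [|split; [|split; [|split]]].
  - intros w gh Hw. now apply equilibrium_unique with w1.
  - intros w0 gh0 Hw0. now apply (solution_exists g (Derive g) J h alpha wrd w1 (gu - gl)).
  - intros w gh Hsol [_ H0].
    now apply (solution_invariant g (Derive g) J h alpha wrd w1 (gu - gl)) with gh.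
  - intros eps Heps.
    now apply (solution_stable g (Derive g) J h alpha wrd w1 (gu - gl)) with k q.
  - intros w gh Hsol [_ H0].
    now apply (solution_attracted g (Derive g) J h alpha wrd w1 (gu - gl)) with k q.
Qed.
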